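(* Let $\mathcal S=\mathcal S(\mathcal P_{\mathbf d},\mathcal X,\mathcal K)$ and $\widehat{\mathcal S}=\mathcal S(\mathcal P_{\mathbf d},\mathcal X,\widehat{\mathcal K})$ be multi-degree spline spaces on $[a,b]$ with the same breakpoints $\mathcal X=\{x_i\}_{i=1}^q$ and degrees $\mathbf d=(d_0,\dots,d_q)$ and with continuity vectors $\mathcal K=(k_1,\dots,k_j,\dots,k_q)$ and $\widehat{\mathcal K}=(k_1,\dots,k_j-1,\dots,k_q)$ for some $j\in\{1,\dots,q\}$. Let $K=\dim\mathcal S$, let $\{N_{i,m}\}_{i=1}^K$ and $\{\hat N_{i,m}\}_{i=1}^{K+1}$ be the MDB-spline bases of $\mathcal S$ and $\widehat{\mathcal S}$, let $\ell$ be the index such that $s_\ell\le x_j<\min(s_{\ell+1},b)$, where $\{s_i\}$ is the left extended partition of $\mathcal S$, and let $\alpha_1,\dots,\alpha_{K+1}$ be the reverse knot insertion coefficients, i.e. the coefficients with $\alpha_i=1$ for $i=1,\dots,\ell-d_j$, $\alpha_i\in\,]0,1[$ for $i=\ell-d_j+1,\dots,\ell-d_j+k_j$, $\alpha_i=0$ for $i=\ell-d_j+k_j+1,\dots,K+1$, and $$N_{i,m}=\alpha_i\hat N_{i,m}+(1-\alpha_{i+1})\hat N_{i+1,m},\qquad i=1,\dots,K.$$ Let $\xi_i$ and $\hat\xi_i$ denote the Greville abscissae of $\mathcal S$ and $\widehat{\mathcal S}$, respectively. Then the coefficients $\alpha_i$ can be computed as $$\alpha_i=\frac{\hat\xi_i-\xi_{i-1}}{\xi_i-\xi_{i-1}},\qquad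 i=\ell-d_j+1,\dots,\ell-d_j+k_j.$$
   Context: **Multi-degree spline space.** Let $\mathcal X=\{x_i\}_{i=1}^q$ with $a=x_0<x_1<\dots<x_q<x_{q+1}=b$, $\mathbf d=(d_0,\dots,d_q)$ a vector of nonnegative integers, $\mathcal K=(k_1,\dots,k_q)$ a vector of nonnegative integers with $k_i\le\min\{d_{i-1},d_i\}$. $\mathcal S(\mathcal P_{\mathbf d},\mathcal X,\mathcal K)$ is the set of functions $f$ on $[a,b]$ for which there are polynomials $p_i$ of degree at most $d_i$, $i=0,\dots,q$, with $f=p_i$ on $[x_i,x_{i+1}]$ and $D^\ell p_{i-1}(x_i)=D^\ell p_i(x_i)$ for $\ell=0,\dots,k_i$, $i=1,\dots,q$. Its dimension is $K=d_0+1+\sum_{i=1}^q(d_i-k_i)$. **Extended partitions.** The left extended partition $\mathbf s=\{s_j\}_{j=1}^K$ lists $a$ repeated $d_0+1$ times, then $x_1$ repeated $d_1-k_1$ times, ..., then $x_q$ repeated $d_q-k_q$ times. The right extended partition $\mathbf t=\{t_j\}_{j=1}^K$ lists $x_1$ repeated $d_0-k_1$ times, ..., $x_q$ repeated $d_{q-1}-k_q$ times, then $b$ repeated $d_q+1$ times. Put $s_{K+1}:=b$. **MDB-spline basis.** Let $m=\max_i d_i$. For $n=0,\dots,m$ and $i=m+1-n,\dots,K$, the function $N_{i,n}$ is supported on $[s_i,t_{i-m+n}]$ and, on each nontrivial breakpoint interval $[x_j,x_{j+1})\subset[s_i,t_{i-m+n}]$, is given by - $N_{i,n}(x)=1$ if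 $n=m-d_j$; - $N_{i,n}(x)=\int_{-\infty}^x\big[\delta_{i,n-1}N_{i,n-1}(u)-\delta_{i+1,n-1}N_{i+1,n-1}(u)\big]du$ if $n>m-d_j$; - $N_{i,n}(x)=0$ otherwise, where $\delta_{i,n}=\big(\int_{-\infty}^{+\infty}N_{i,n}(x)\,dx\big)^{-1}$. Functions $N_{i,n}$ that are undefined (index out of range, or $s_i\ge t_{i-m+n}$) are taken to be zero, and for them one sets $\int_{-\infty}^x\delta_{i,n}N_{i,n}(u)\,du:=0$ for $x<s_i$ and $:=1$ for $x\ge s_i$. Values at $b$ are taken as limits from the left. The MDB-spline basis of $\mathcal S$ is $\{N_{i,m}\}_{i=1}^K$. It is known that these functions form a basis of $\mathcal S$, that $N_{i,m}$ vanishes outside $[s_i,t_i]$ and is positive on $(s_i,t_i)$, and that $\sum_iN_{i,m}=1$ on $[a,b]$. The basis $\{\hat N_{i,m}\}_{i=1}^{K+1}$ of $\widehat{\mathcal S}$ is defined in the same way from the extended partitions of $\widehat{\mathcal S}$. **Reverse knot insertion coefficients (known fact).** In the setting of the claim one has $\mathcal S\subset\widehat{\mathcal S}$, and coefficients $\alpha_1,\dots,\alpha_{K+1}$ with the properties listed in the claim exist. **Greville abscissae.** The Greville abscissae of $\mathcal S$ are the coefficients $\xi_1,\dots,\xi_K$ such that $\sum_{i=1}^K\xi_iN_{i,m}(x)=x$ for all $x\in[x_h,x_{h+1}]$ and all $h\in\{0,\dots,q\}$ such that $d_h\ge1$. The Greville abscissae $\hat\xi_1,\dots,\hat\xi_{K+1}$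 of $\widehat{\mathcal S}$ are defined in the same way with respect to $\{\hat N_{i,m}\}$. *)

(* Defs.v *)
From Stdlib Require Import Reals List Arith ClassicalEpsilon.
From Coquelicot Require Import Coquelicot.
Open Scope R_scope.

(** Parameters of a multi-degree spline space S(P_d, X, K).  The interval is
    [a,b] with a = bkpt 0 and b = bkpt (nbk + 1).  Only bkpt 0 .. nbk+1,
    deg 0 .. nbk and smooth 1 .. nbk are meaningful.  The MDB-spline basis and
    the Greville abscissae depend on the space through these parameters only. *)
Record mdspace := MDSpace {
  nbk : nat;
  bkpt : nat -> R;
  deg : nat -> nat;
  smooth : nat -> nat
}.

Definition left_end (S : mdspace) : R := bkpt S 0.
Definition right_end (S : mdspace) : R := bkpt S (nbk S + 1).

Definition valid_mdspace (S : mdspace) : Prop :=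
  (forall i, (i <= nbk S)%nat -> bkpt S i < bkpt S (i + 1)) /\
  (forall i, (1 <= i <= nbk S)%nat ->
     (smooth S i <= Nat.min (deg S (i - 1)) (deg S i))%nat).

(** Meaningful only when [1 <= smooth S j], because of truncated subtraction. *)
Definition lower_smoothness (S : mdspace) (j : nat) : mdspace :=
  MDSpace (nbk S) (bkpt S) (deg S)
    (fun i => if Nat.eqb i j then (smooth S i - 1)%nat else smooth S i).

Definition max_deg (S : mdspace) : nat :=
  list_max (map (deg S) (seq 0 (nbk S + 1))).

(** The dimension K of the space. *)
Definition dimS (S : mdspace) : nat :=
  (deg S 0 + 1 +
   list_sum (map (fun i => deg S i - smooth S i) (seq 1 (nbk S))))%nat.

Definition left_partition (S : mdspace) : list R :=
  repeat (left_end S) (deg S 0 + 1) ++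
  flat_map (fun i => repeat (bkpt S i) (deg S i - smooth S i)) (seq 1 (nbk S)).

Definition right_partition (S : mdspace) : list R :=
  flat_map (fun i => repeat (bkpt S i) (deg S (i - 1) - smooth S i))
    (seq 1 (nbk S)) ++
  repeat (right_end S) (deg S (nbk S) + 1).

(** Both partitions are indexed from 1; the default value of [nth] provides the
    convention s_{K+1} = b. *)
Definition sknot (S : mdspace) (i : nat) : R :=
  nth (i - 1) (left_partition S) (right_end S).
Definition tknot (S : mdspace) (i : nat) : R :=
  nth (i - 1) (right_partition S) (right_end S).

(** N_{i,n} is defined when m+1-n <= i <= K and s_i < t_{i-m+n}. *)
Definition mdb_defined (S : mdspace) (n i : nat) : Prop :=
  (max_deg S + 1 <= i + n)%nat /\ (i <= dimS S)%nat /\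
  sknot S i < tknot S (i + n - max_deg S).

(** The largest h <= p with x_h <= u (and 0 if there is none). *)
Fixpoint cell (S : mdspace) (p : nat) (u : R) : nat :=
  match p with
  | O => O
  | Datatypes.S p' => if Rle_dec (bkpt S p) u then p else cell S p' u
  end.

(** u lies in the breakpoint interval [x_h, x_{h+1}), which is contained in the
    support interval [s_i, t_{i-m+n}] of a defined N_{i,n}. *)
Definition in_support_cell (S : mdspace) (n i h : nat) (u : R) : Prop :=
  mdb_defined S n i /\
  sknot S i <= bkpt S h /\ bkpt S (h + 1) <= tknot S (i + n - max_deg S) /\
  bkpt S h <= u < bkpt S (h + 1).

Definition mdb_delta (f : R -> R) : R :=
  / RInt_gen f (Rbar_locally m_infty) (Rbar_locally p_infty).

(** The integral of delta_{i,n} N_{i,n} over (-oo, u], for f = N_{i,n}, with the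
    unit step at s_i as its value when N_{i,n} is undefined. *)
Definition mdb_cumul (S : mdspace) (n i : nat) (f : R -> R) (u : R) : R :=
  if excluded_middle_informative (mdb_defined S n i) then
    RInt_gen (fun v => mdb_delta f * f v) (Rbar_locally m_infty) (at_point u)
  else if Rle_dec (sknot S i) u then 1 else 0.

(** Replaces the value at b by the limit from the left. *)
Definition left_limit_at_end (S : mdspace) (g : R -> R) (u : R) : R :=
  if Req_EM_T u (right_end S) then lim (filtermap g (at_left (right_end S)))
  else g u.

(** [mdb S n i] is N_{i,n}.  The integral of the difference in the recurrence is
    split in two, as the convention for undefined functions requires. *)
Fixpoint mdb (S : mdspace) (n i : nat) : R -> R :=
  left_limit_at_end S (fun u =>
    let h := cell S (nbk S) u in
    if excluded_middle_informative (in_support_cell S n i h u) then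
      if Nat.eqb n (max_deg S - deg S h) then 1
      else if Nat.ltb (max_deg S - deg S h) n then
        match n with
        | O => 0
        | Datatypes.S n' =>
            mdb_cumul S n' i (mdb S n' i) u
            - mdb_cumul S n' (i + 1) (mdb S n' (i + 1)) u
        end
      else 0
    else 0).

Definition mdb_basis (S : mdspace) (i : nat) : R -> R := mdb S (max_deg S) i.

(** xi 1, ..., xi K are the Greville abscissae. *)
Definition is_greville (S : mdspace) (xi : nat -> R) : Prop :=
  forall h, (h <= nbk S)%nat -> (1 <= deg S h)%nat ->
  forall u, bkpt S h <= u <= bkpt S (h + 1) ->
    sum_n_m (fun i => xi i * mdb_basis S i u) 1 (dimS S) = u.

(* Main.v *)
(** Substituting N_i = alpha_i N^_i + (1 - alpha_{i+1}) N^_{i+1} into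
    sum xi_i N_i = x gives xi^_i = alpha_i xi_i + (1 - alpha_i) xi_{i-1} wherever
    the N^_i are linearly independent, in particular for the d_j + 1 functions
    living on [x_j, x_{j+1}); one then divides by xi_i - xi_{i-1}, which is the
    integral of N_{i,m-1}.

    Both facts rest on the normalising integrals being nonzero, which goes by
    induction on the level n.  Write C_{i,n} for the integral of
    delta_{i,n} N_{i,n}, so that N_{i,n} = C_{i,n-1} - C_{i+1,n-1}.  A
    combination of w consecutive C_{i,n} cannot have w + 1 consecutive increments
    of alternating signs: such increments would give w + 1 alternating values of
    a combination of N_{i,n}, hence, the limits at both ends being 0, w + 2
    alternating increments of a combination of w + 1 functions C_{i,n-1}.  So
    N_{i,n} has constant sign.  It is not identically zero, since the N_{i,n} are
    linearly independent on each breakpoint interval (differentiate a vanishing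
    combination). *)

Require Import Defs.
From Stdlib Require Import Reals List Arith Lia Lra Classical ClassicalEpsilon.
From Coquelicot Require Import Coquelicot.
Open Scope R_scope.

(** * Knots and supports *)

(** [Lcount M h] counts the s_i with s_i <= x_h and [Tcount M h] the t_i with
    t_i <= x_h. *)
Definition Lcount (M : mdspace) (h : nat) : nat :=
  (deg M 0 + 1 + list_sum (map (fun i => deg M i - smooth M i) (seq 1 h)))%nat.

Definition Tcount (M : mdspace) (h : nat) : nat :=
  list_sum (map (fun i => deg M (i - 1) - smooth M i)%nat (seq 1 h)).

(** Half-open like the cells in the definition of the basis, so that the value at [b], a left limit,
    never has to be computed. *)
Definition in_cell (M : mdspace) (h : nat) (u : R) : Prop :=
  (h <= nbk M)%nat /\ bkpt M h <= u < bkpt M (h + 1).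

Lemma bkpt_le (M : mdspace) (HM : valid_mdspace M) (p r : nat) :
  (p <= r)%nat -> (r <= nbk M + 1)%nat -> bkpt M p <= bkpt M r.
Proof.
  induction 1 as [|r Hpr IH]; intros Hr; [lra|].
  destruct HM as [Hx _]. specialize (Hx r ltac:(lia)).
  replace (r + 1)%nat with (S r) in Hx by lia. specialize (IH ltac:(lia)). lra.
Qed.

Lemma bkpt_lt_succ (M : mdspace) (HM : valid_mdspace M) (h : nat) :
  (h <= nbk M)%nat -> bkpt M h < bkpt M (h + 1).
Proof. apply HM. Qed.

Lemma in_cell_bounds (M : mdspace) (HM : valid_mdspace M) (h : nat) (u : R) :
  in_cell M h u -> left_end M <= u < right_end M.
Proof.
  intros [Hh Hu]. unfold left_end, right_end.
  pose proof (bkpt_le M HM 0 h ltac:(lia) ltac:(lia)).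
  pose proof (bkpt_le M HM (h + 1) (nbk M + 1) ltac:(lia) ltac:(lia)). lra.
Qed.

Lemma in_cell_exists (M : mdspace) (u : R) :
  left_end M <= u < right_end M -> exists h, in_cell M h u.
Proof.
  unfold left_end, right_end, in_cell. intros [Ha Hb].
  assert (H : forall p, (p <= nbk M)%nat -> u < bkpt M (p + 1) ->
    exists h, (h <= nbk M)%nat /\ bkpt M h <= u < bkpt M (h + 1)).
  { induction p as [|p IH]; intros Hp Hu.
    - exists 0%nat. auto with arith.
    - destruct (Rle_lt_dec (bkpt M (S p)) u).
      + exists (S p). auto.
      + apply IH; [lia|]. replace (p + 1)%nat with (S p) by lia. lra. }
  apply (H (nbk M)); auto.
Qed.

Lemma Lcount_S (M : mdspace) (h : nat) :
  Lcount M (S h) = (Lcount M h + (deg M (S h) - smooth M (S h)))%nat.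
Proof.
  unfold Lcount. rewrite seq_S, map_app, list_sum_app. simpl. lia.
Qed.

Lemma Tcount_S (M : mdspace) (h : nat) :
  Tcount M (S h) = (Tcount M h + (deg M h - smooth M (S h)))%nat.
Proof.
  unfold Tcount. rewrite seq_S, map_app, list_sum_app. simpl.
  rewrite Nat.sub_0_r. lia.
Qed.

(** Crossing [x_h] adds [d_h - k_h] to one count and [d_{h-1} - k_h] to the other; the bound on
    [smooth] keeps both subtractions exact, so the difference telescopes to the degree. At level [m]
    the indices from [Tcount M h + 1] to [Lcount M h] are thus the [d_h + 1] functions living on the
    cell. *)
Lemma Lcount_Tcount (M : mdspace) (HM : valid_mdspace M) (h : nat) :
  (h <= nbk M)%nat -> Lcount M h = (Tcount M h + deg M h + 1)%nat.
Proof.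
  induction h as [|h IH]; intros Hh.
  - unfold Lcount, Tcount. simpl. lia.
  - rewrite Lcount_S, Tcount_S, IH by lia.
    destruct HM as [_ Hk]. specialize (Hk (S h) ltac:(lia)).
    replace (S h - 1)%nat with h in Hk by lia. lia.
Qed.

Lemma Lcount_le (M : mdspace) (p r : nat) :
  (p <= r)%nat -> (Lcount M p <= Lcount M r)%nat.
Proof. induction 1; [lia|]. rewrite Lcount_S. lia. Qed.

Lemma Tcount_le (M : mdspace) (p r : nat) :
  (p <= r)%nat -> (Tcount M p <= Tcount M r)%nat.
Proof. induction 1; [lia|]. rewrite Tcount_S. lia. Qed.

Lemma dimS_Lcount (M : mdspace) : dimS M = Lcount M (nbk M).
Proof. reflexivity. Qed.

Lemma deg_le_max (M : mdspace) (h : nat) :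
  (h <= nbk M)%nat -> (deg M h <= max_deg M)%nat.
Proof.
  intros Hh. unfold max_deg.
  pose proof (proj1 (list_max_le (map (deg M) (seq 0 (nbk M + 1))) _) (le_n _)) as H.
  rewrite Forall_forall in H. apply H, in_map, in_seq. lia.
Qed.

Lemma length_flat_map_repeat (x : nat -> R) (c : nat -> nat) (l : list nat) :
  length (flat_map (fun i => repeat (x i) (c i)) l) = list_sum (map c l).
Proof.
  induction l as [|i l IH]; simpl; [reflexivity|].
  now rewrite length_app, repeat_length, IH.
Qed.

Lemma in_flat_map_repeat (x : nat -> R) (c : nat -> nat) (l : list nat) (y : R) :
  In y (flat_map (fun i => repeat (x i) (c i)) l) -> exists i, In i l /\ y = x i.
Proof.
  rewrite in_flat_map. intros [i [Hi Hy]]. exists i. split; [assumption|].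
  now apply repeat_spec in Hy.
Qed.

Lemma seq_split (h q : nat) :
  (h <= q)%nat -> seq 1 q = seq 1 h ++ seq (1 + h) (q - h).
Proof. intros H. rewrite <- seq_app. f_equal. lia. Qed.

Lemma nth_app_le (A B : list R) (d y : R) (k : nat) :
  (k < length A)%nat -> (forall z, In z A -> z <= y) -> nth k (A ++ B) d <= y.
Proof. intros Hk HA. rewrite app_nth1 by assumption. apply HA, nth_In, Hk. Qed.

Lemma nth_app_ge (A B : list R) (d y : R) (k : nat) :
  (length A <= k)%nat -> (forall z, In z B -> y <= z) -> y <= d ->
  y <= nth k (A ++ B) d.
Proof.
  intros Hk HB Hd. rewrite app_nth2 by lia.
  destruct (Nat.lt_ge_cases (k - length A) (length B)).
  - now apply HB, nth_In.
  - now rewrite nth_overflow.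
Qed.

Lemma left_partition_split (M : mdspace) (h : nat) : (h <= nbk M)%nat ->
  left_partition M =
  (repeat (left_end M) (deg M 0 + 1) ++
   flat_map (fun i => repeat (bkpt M i) (deg M i - smooth M i)) (seq 1 h)) ++
  flat_map (fun i => repeat (bkpt M i) (deg M i - smooth M i))
    (seq (1 + h) (nbk M - h)).
Proof.
  intros Hh. unfold left_partition.
  now rewrite (seq_split h (nbk M) Hh), flat_map_app, app_assoc.
Qed.

Lemma right_partition_split (M : mdspace) (h : nat) : (h <= nbk M)%nat ->
  right_partition M =
  flat_map (fun i => repeat (bkpt M i) (deg M (i - 1) - smooth M i)) (seq 1 h) ++
  (flat_map (fun i => repeat (bkpt M i) (deg M (i - 1) - smooth M i))
    (seq (1 + h) (nbk M - h)) ++ repeat (right_end M) (deg M (nbk M) + 1)).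
Proof.
  intros Hh. unfold right_partition.
  now rewrite (seq_split h (nbk M) Hh), flat_map_app, app_assoc.
Qed.

Lemma sknot_le (M : mdspace) (HM : valid_mdspace M) (h i : nat) :
  (h <= nbk M)%nat -> (i <= Lcount M h)%nat -> sknot M i <= bkpt M h.
Proof.
  intros Hh Hi. unfold sknot. rewrite (left_partition_split M h Hh).
  apply nth_app_le.
  - rewrite length_app, repeat_length, length_flat_map_repeat.
    unfold Lcount in Hi. lia.
  - intros z Hz. apply in_app_or in Hz as [Hz|Hz].
    + apply repeat_spec in Hz as ->. apply bkpt_le; auto; lia.
    + apply in_flat_map_repeat in Hz as [r [Hr ->]]. apply in_seq in Hr.
      apply bkpt_le; auto; lia.
Qed.

Lemma sknot_ge (M : mdspace) (HM : valid_mdspace M) (h i : nat) :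
  (h <= nbk M)%nat -> (Lcount M h < i)%nat -> bkpt M (h + 1) <= sknot M i.
Proof.
  intros Hh Hi. unfold sknot. rewrite (left_partition_split M h Hh).
  apply nth_app_ge.
  - rewrite length_app, repeat_length, length_flat_map_repeat.
    unfold Lcount in Hi. lia.
  - intros z Hz. apply in_flat_map_repeat in Hz as [r [Hr ->]]. apply in_seq in Hr.
    apply bkpt_le; auto; lia.
  - apply bkpt_le; auto; lia.
Qed.

Lemma tknot_le (M : mdspace) (HM : valid_mdspace M) (h i : nat) :
  (h <= nbk M)%nat -> (1 <= i <= Tcount M h)%nat -> tknot M i <= bkpt M h.
Proof.
  intros Hh Hi. unfold tknot. rewrite (right_partition_split M h Hh).
  apply nth_app_le.
  - rewrite length_flat_map_repeat. unfold Tcount in Hi. lia.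
  - intros z Hz. apply in_flat_map_repeat in Hz as [r [Hr ->]]. apply in_seq in Hr.
    apply bkpt_le; auto; lia.
Qed.

Lemma tknot_ge (M : mdspace) (HM : valid_mdspace M) (h i : nat) :
  (h <= nbk M)%nat -> (Tcount M h < i)%nat -> bkpt M (h + 1) <= tknot M i.
Proof.
  intros Hh Hi. unfold tknot. rewrite (right_partition_split M h Hh).
  apply nth_app_ge.
  - rewrite length_flat_map_repeat. unfold Tcount in Hi. lia.
  - intros z Hz. apply in_app_or in Hz as [Hz|Hz].
    + apply in_flat_map_repeat in Hz as [r [Hr ->]]. apply in_seq in Hr.
      apply bkpt_le; auto; lia.
    + apply repeat_spec in Hz as ->. apply bkpt_le; auto; lia.
  - apply bkpt_le; auto; lia.
Qed.

Lemma sknot_bounds (M : mdspace) (HM : valid_mdspace M) (i : nat) :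
  left_end M <= sknot M i <= right_end M.
Proof.
  split.
  - destruct (Nat.le_gt_cases i (Lcount M 0)) as [Hi|Hi].
    + unfold sknot. rewrite (left_partition_split M 0) by lia.
      change (seq 1 0) with (@nil nat). simpl flat_map at 1. rewrite app_nil_r.
      rewrite app_nth1.
      * apply Req_le. symmetry.
        apply (repeat_spec (deg M 0 + 1)), nth_In.
        rewrite repeat_length. unfold Lcount in Hi. simpl in Hi. lia.
      * rewrite repeat_length. unfold Lcount in Hi. simpl in Hi. lia.
    + eapply Rle_trans; [|apply (sknot_ge M HM 0 i); auto; lia].
      apply bkpt_le; auto; lia.
  - destruct (Nat.le_gt_cases i (Lcount M (nbk M))) as [Hi|Hi].
    + eapply Rle_trans; [apply (sknot_le M HM (nbk M) i); auto; lia|].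
      apply bkpt_le; auto; lia.
    + unfold sknot. rewrite nth_overflow; [lra|].
      rewrite (left_partition_split M (nbk M)), Nat.sub_diag by lia. simpl.
      rewrite app_nil_r, length_app, repeat_length, length_flat_map_repeat.
      unfold Lcount in Hi. lia.
Qed.

(** No left knot lies strictly inside a cell, so comparing a knot with [u] amounts to counting.
    Positions of knots can then be handled as inequalities between indices. *)
Lemma sknot_le_iff (M : mdspace) (HM : valid_mdspace M) (h i : nat) (u : R) :
  in_cell M h u -> (sknot M i <= u <-> (i <= Lcount M h)%nat).
Proof.
  intros [Hh Hu]. split; intros H.
  - destruct (Nat.le_gt_cases i (Lcount M h)) as [Hi|Hi]; [assumption|].
    pose proof (sknot_ge M HM h i Hh Hi). lra.
  - pose proof (sknot_le M HM h i Hh H). lra.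
Qed.

Lemma sknot_mono (M : mdspace) (HM : valid_mdspace M) (i i' : nat) :
  (i <= i')%nat -> sknot M i <= sknot M i'.
Proof.
  intros Hi. destruct (Rlt_le_dec (sknot M i') (right_end M)) as [Hb|Hb].
  - pose proof (sknot_bounds M HM i').
    destruct (in_cell_exists M (sknot M i') ltac:(lra)) as [h Hh].
    apply (sknot_le_iff M HM h i _ Hh).
    pose proof (proj1 (sknot_le_iff M HM h i' _ Hh) (Rle_refl _)). lia.
  - pose proof (sknot_bounds M HM i). lra.
Qed.

(** The support condition [s_i <= x_h /\ x_{h+1} <= t_{i-m+n}], in terms of
    indices. *)
Definition supported (M : mdspace) (n i h : nat) : Prop :=
  (i <= Lcount M h /\ Tcount M h + max_deg M < i + n)%nat.

Lemma in_support_cell_iff (M : mdspace) (HM : valid_mdspace M) (n i h : nat) (u : R) :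
  in_cell M h u -> (in_support_cell M n i h u <-> supported M n i h).
Proof.
  intros [Hh Hu]. unfold supported. pose proof (bkpt_lt_succ M HM h Hh) as Hx. split.
  - intros [[H1 [H2 H3]] [H4 [H5 _]]]. split.
    + apply (sknot_le_iff M HM h i (bkpt M h)); [split; auto; lra|assumption].
    + destruct (Nat.le_gt_cases (i + n) (Tcount M h + max_deg M)); [|assumption].
      pose proof (tknot_le M HM h (i + n - max_deg M) Hh ltac:(lia)). lra.
  - intros [H1 H2].
    pose proof (sknot_le M HM h i Hh H1).
    pose proof (tknot_ge M HM h (i + n - max_deg M) Hh ltac:(lia)).
    pose proof (Lcount_le M h (nbk M) Hh).
    repeat split; try lra; try lia. rewrite dimS_Lcount. lia.
Qed.

(** The first cell whose [Lcount] reaches [i] starts no later than [s_i]; as [s_i < t_{i-m+n}], the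
    latter is not among the right knots counted by [Tcount] at that cell. *)
Lemma mdb_defined_supported (M : mdspace) (HM : valid_mdspace M) (n i : nat) :
  mdb_defined M n i -> exists h, (h <= nbk M)%nat /\ supported M n i h.
Proof.
  intros [H1 [H2 H3]]. rewrite dimS_Lcount in H2.
  assert (H : forall p, (p <= nbk M)%nat -> (i <= Lcount M p)%nat ->
    exists h, (h <= nbk M)%nat /\ (i <= Lcount M h)%nat /\ bkpt M h <= sknot M i).
  { induction p as [|p IH]; intros Hp Hi.
    - exists 0%nat. repeat split; auto. apply sknot_bounds, HM.
    - destruct (Nat.le_gt_cases i (Lcount M p)) as [Hip|Hip]; [apply IH; auto; lia|].
      exists (S p). repeat split; auto.
      pose proof (sknot_ge M HM p i ltac:(lia) Hip) as Hs.
      now replace (p + 1)%nat with (S p) in Hs by lia. }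
  destruct (H (nbk M) (le_n _) H2) as [h [Hh [Hi Hx]]].
  exists h. split; [assumption|]. split; [assumption|].
  destruct (Nat.le_gt_cases (i + n) (Tcount M h + max_deg M)); [|assumption].
  pose proof (tknot_le M HM h (i + n - max_deg M) Hh ltac:(lia)). lra.
Qed.

Lemma supported_defined (M : mdspace) (HM : valid_mdspace M) (n i h : nat) :
  (h <= nbk M)%nat -> supported M n i h -> mdb_defined M n i.
Proof.
  intros Hh H. pose proof (bkpt_lt_succ M HM h Hh) as Hx.
  apply (in_support_cell_iff M HM n i h (bkpt M h)) in H; [apply H|split; auto; lra].
Qed.

Lemma cell_unique (M : mdspace) (HM : valid_mdspace M) (h : nat) (u : R) :
  in_cell M h u -> cell M (nbk M) u = h.
Proof.
  intros [Hh Hu].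
  assert (H : forall p, (h <= p <= nbk M)%nat -> cell M p u = h); [|apply H; lia].
  induction p as [|p IH]; intros Hp; simpl; [lia|].
  destruct (Nat.eq_dec h (S p)) as [->|Hne].
  - destruct (Rle_dec (bkpt M (S p)) u); [reflexivity|lra].
  - pose proof (bkpt_le M HM (h + 1) (S p) ltac:(lia) ltac:(lia)).
    destruct (Rle_dec (bkpt M (S p)) u); [lra|]. apply IH. lia.
Qed.

Lemma cell_le (M : mdspace) (p : nat) (u : R) : (cell M p u <= p)%nat.
Proof. induction p; simpl; [lia|]. destruct Rle_dec; lia. Qed.

(** N_{i,n} with support containing the cell [h] exist. *)
Definition active (M : mdspace) (n h : nat) : Prop := (max_deg M <= n + deg M h)%nat.

Lemma supported_active (M : mdspace) (HM : valid_mdspace M) (n i h : nat) :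
  (h <= nbk M)%nat -> supported M n i h -> active M n h.
Proof.
  unfold supported, active. intros Hh H.
  pose proof (Lcount_Tcount M HM h Hh). lia.
Qed.

(** * Values of [mdb] on a single cell *)

Lemma mdb_unfold (M : mdspace) (n i : nat) :
  mdb M n i = left_limit_at_end M (fun u =>
    let h := cell M (nbk M) u in
    if excluded_middle_informative (in_support_cell M n i h u) then
      if Nat.eqb n (max_deg M - deg M h) then 1
      else if Nat.ltb (max_deg M - deg M h) n then
        match n with
        | O => 0
        | S n' =>
            mdb_cumul M n' i (mdb M n' i) u
            - mdb_cumul M n' (i + 1) (mdb M n' (i + 1)) u
        end
      else 0
    else 0).
Proof. destruct n; reflexivity. Qed.

Lemma mdb_unsupported (M : mdspace) (HM : valid_mdspace M) (n i h : nat) (u : R) :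
  in_cell M h u -> ~ supported M n i h -> mdb M n i u = 0.
Proof.
  intros Hu Hs. rewrite mdb_unfold. unfold left_limit_at_end.
  pose proof (in_cell_bounds M HM h u Hu).
  destruct Req_EM_T as [He|_]; [lra|]. cbv zeta.
  rewrite (cell_unique M HM h u Hu).
  destruct excluded_middle_informative as [Hi|_]; [|reflexivity].
  now apply (in_support_cell_iff M HM n i h u Hu) in Hi.
Qed.

Lemma mdb_outside (M : mdspace) (HM : valid_mdspace M) (n i : nat) (u : R) :
  u < left_end M \/ right_end M < u -> mdb M n i u = 0.
Proof.
  intros Hu. rewrite mdb_unfold. unfold left_limit_at_end.
  assert (left_end M < right_end M).
  { unfold left_end, right_end.
    pose proof (bkpt_lt_succ M HM 0 ltac:(lia)).
    pose proof (bkpt_le M HM (0 + 1) (nbk M + 1) ltac:(lia) ltac:(lia)). lra. }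
  destruct Req_EM_T as [He|_]; [lra|]. cbv zeta.
  destruct excluded_middle_informative as [Hi|_]; [|reflexivity].
  (* [cell] returns an index even for [u] outside [[a,b]]; the last clause of [in_support_cell]
     rules such a [u] out. *)
  destruct Hi as [_ [_ [_ Hi]]].
  assert (Hc : in_cell M (cell M (nbk M) u) u) by (split; [apply cell_le|assumption]).
  apply (in_cell_bounds M HM) in Hc. lra.
Qed.

Lemma mdb_top (M : mdspace) (HM : valid_mdspace M) (n i h : nat) (u : R) :
  in_cell M h u -> supported M n i h -> n = (max_deg M - deg M h)%nat ->
  mdb M n i u = 1.
Proof.
  intros Hu Hs Hn. rewrite mdb_unfold. unfold left_limit_at_end.
  pose proof (in_cell_bounds M HM h u Hu).
  destruct Req_EM_T as [He|_]; [lra|]. cbv zeta.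
  rewrite (cell_unique M HM h u Hu).
  destruct excluded_middle_informative as [_|Hi].
  - now apply Nat.eqb_eq in Hn as ->.
  - exfalso. now apply Hi, in_support_cell_iff.
Qed.

Lemma mdb_rec (M : mdspace) (HM : valid_mdspace M) (n i h : nat) (u : R) :
  in_cell M h u -> supported M (S n) i h -> (max_deg M - deg M h < S n)%nat ->
  mdb M (S n) i u =
  mdb_cumul M n i (mdb M n i) u - mdb_cumul M n (i + 1) (mdb M n (i + 1)) u.
Proof.
  intros Hu Hs Hn. rewrite mdb_unfold. unfold left_limit_at_end.
  pose proof (in_cell_bounds M HM h u Hu).
  destruct Req_EM_T as [He|_]; [lra|]. cbv zeta.
  rewrite (cell_unique M HM h u Hu).
  destruct excluded_middle_informative as [_|Hi].
  - destruct (Nat.eqb_spec (S n) (max_deg M - deg M h)); [lia|].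
    apply Nat.ltb_lt in Hn as ->. reflexivity.
  - exfalso. now apply Hi, in_support_cell_iff.
Qed.

(** * Finite sums and oscillations *)

Fixpoint rsum (f : nat -> R) (p w : nat) : R :=
  match w with
  | O => 0
  | S w' => rsum f p w' + f (p + w')%nat
  end.

Lemma rsum_ext (f g : nat -> R) (p w : nat) :
  (forall i, (p <= i < p + w)%nat -> f i = g i) -> rsum f p w = rsum g p w.
Proof.
  induction w as [|w IH]; intros H; simpl; [reflexivity|].
  rewrite IH by (intros i Hi; apply H; lia). f_equal. apply H. lia.
Qed.

Lemma rsum_zero (f : nat -> R) (p w : nat) :
  (forall i, (p <= i < p + w)%nat -> f i = 0) -> rsum f p w = 0.
Proof.
  induction w as [|w IH]; intros H; simpl; [reflexivity|].
  rewrite IH by (intros i Hi; apply H; lia). rewrite H by lia. lra.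
Qed.

Lemma rsum_app (f : nat -> R) (p v w : nat) :
  rsum f p (v + w) = rsum f p v + rsum f (p + v) w.
Proof.
  induction w as [|w IH]; simpl.
  - rewrite Nat.add_0_r. lra.
  - rewrite Nat.add_succ_r. simpl. rewrite IH, Nat.add_assoc. lra.
Qed.

Lemma rsum_first (f : nat -> R) (p w : nat) :
  rsum f p (S w) = f p + rsum f (S p) w.
Proof.
  change (S w) with (1 + w)%nat. rewrite rsum_app. simpl.
  rewrite Nat.add_0_r, Nat.add_1_r. lra.
Qed.

Lemma rsum_plus (f g : nat -> R) (p w : nat) :
  rsum (fun i => f i + g i) p w = rsum f p w + rsum g p w.
Proof. induction w as [|w IH]; simpl; [lra|]. rewrite IH. lra. Qed.

Lemma rsum_minus (f g : nat -> R) (p w : nat) :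
  rsum (fun i => f i - g i) p w = rsum f p w - rsum g p w.
Proof. induction w as [|w IH]; simpl; [lra|]. rewrite IH. lra. Qed.

Lemma rsum_shift (f : nat -> R) (p w : nat) :
  rsum (fun i => f (i + 1)%nat) p w = rsum f (S p) w.
Proof.
  induction w as [|w IH]; simpl; [reflexivity|].
  rewrite IH. do 2 f_equal. lia.
Qed.

Lemma rsum_sum_n_m (f : nat -> R) (p w : nat) :
  (1 <= p)%nat -> sum_n_m f p (p + w - 1) = rsum f p w.
Proof.
  intros Hp. induction w as [|w IH].
  - rewrite sum_n_m_zero by lia. reflexivity.
  - replace (p + S w - 1)%nat with (S (p + w - 1)) by lia.
    rewrite sum_n_Sm by lia. rewrite IH. unfold plus; simpl. do 2 f_equal. lia.
Qed.

Lemma rsum_abel (c G : nat -> R) (p w : nat) :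
  rsum (fun i => c i * (G i - G (i + 1)%nat)) p (S w) =
  c p * G p + rsum (fun i => (c i - c (i - 1)%nat) * G i) (S p) w
  - c (p + w)%nat * G (S (p + w)).
Proof.
  induction w as [|w IH].
  - simpl. rewrite Nat.add_0_r, Nat.add_1_r. lra.
  - change (rsum (fun i => c i * (G i - G (i + 1)%nat)) p (S (S w))) with
      (rsum (fun i => c i * (G i - G (i + 1)%nat)) p (S w)
       + c (p + S w)%nat * (G (p + S w)%nat - G (p + S w + 1)%nat)).
    rewrite IH. simpl. replace (p + S w)%nat with (S (p + w)) by lia.
    replace (S (p + w) - 1)%nat with (p + w)%nat by lia.
    rewrite Nat.sub_0_r, Nat.add_1_r. lra.
Qed.

(** The coefficients [e] are chosen before [G], so one choice serves the values of the functions at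
    every point [u]. *)
Lemma rsum_differences (c : nat -> R) (p w : nat) :
  exists e : nat -> R, forall G : nat -> R,
    rsum (fun i => c i * (G i - G (i + 1)%nat)) p w =
    rsum (fun i => e i * G i) p (S w).
Proof.
  induction w as [|w [e IH]].
  - exists (fun _ => 0). intros G. simpl. lra.
  - exists (fun i => if Nat.eqb i (p + S w) then - c (p + w)%nat
              else if Nat.eqb i (p + w) then e i + c i else e i).
    intros G. cbn [rsum]. rewrite IH. cbn [rsum].
    rewrite !(Nat.add_succ_r p w), !Nat.eqb_refl, (Nat.add_1_r (p + w)).
    replace (Nat.eqb (p + w) (S (p + w))) with false
      by (symmetry; apply Nat.eqb_neq; lia).
    rewrite (rsum_ext (fun i => (if Nat.eqb i (S (p + w)) then - c (p + w)%nat
              else if Nat.eqb i (p + w) then e i + c i else e i) * G i)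
              (fun i => e i * G i)).
    + lra.
    + intros i Hi.
      destruct (Nat.eqb_spec i (S (p + w))); [lia|].
      destruct (Nat.eqb_spec i (p + w)); [lia|reflexivity].
Qed.

(** [sigma] carries the sign of the first of [N] alternating increments. *)
Definition oscillates (g : R -> R) (N : nat) : Prop :=
  exists (sigma : R) (v : nat -> R), forall j, (j < N)%nat ->
    v j < v (S j) /\ 0 < sigma * (-1) ^ j * (g (v (S j)) - g (v j)).

(** Variation diminution, phrased with increments instead of zeros or derivatives: this makes sense
    for discontinuous unit steps and passes through integration. *)
Definition few_oscillations (F : nat -> R -> R) : Prop :=
  forall (p w : nat) (c : nat -> R),
    ~ oscillates (fun u => rsum (fun i => c i * F i u) p w) (S w).

Lemma oscillates_le (g : R -> R) (N N' : nat) :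
  (N' <= N)%nat -> oscillates g N -> oscillates g N'.
Proof. intros HN [s [v H]]. exists s, v. intros j Hj. apply H. lia. Qed.

Lemma oscillates_ext (g h : R -> R) (k sigma : R) (v : nat -> R) (N0 N1 : nat) :
  (forall j, (N0 <= j < N1)%nat ->
    v j < v (S j) /\ 0 < sigma * (-1) ^ j * (g (v (S j)) - g (v j))) ->
  (forall j, (N0 <= j <= N1)%nat -> g (v j) = h (v j) + k) ->
  oscillates h (N1 - N0).
Proof.
  intros Hv Hg. exists (sigma * (-1) ^ N0), (fun j => v (N0 + j)%nat).
  intros j Hj. rewrite Nat.add_succ_r.
  destruct (Hv (N0 + j)%nat ltac:(lia)) as [H1 H2]. split; [assumption|].
  rewrite pow_add in H2. rewrite !Hg in H2 by lia.
  eapply Rlt_le_trans; [exact H2|]. apply Req_le. ring.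
Qed.

Lemma increasing_threshold (v : nat -> R) (s : R) (N : nat) :
  (forall j, (j < N)%nat -> v j < v (S j)) ->
  exists J, (J <= S N)%nat /\ (forall j, (j < J)%nat -> v j < s) /\
    (forall j, (J <= j <= N)%nat -> s <= v j).
Proof.
  induction N as [|N IH]; intros Hv.
  - destruct (Rlt_le_dec (v 0%nat) s) as [H|H].
    + exists 1%nat. repeat split; [lia| |lia].
      intros j Hj. now replace j with 0%nat by lia.
    + exists 0%nat. repeat split; [lia|lia|].
      intros j Hj. now replace j with 0%nat by lia.
  - destruct IH as [J [HJ [H1 H2]]]; [intros; apply Hv; lia|].
    destruct (Rlt_le_dec (v (S N)) s) as [H|H].
    + assert (J = S N).
      { destruct (Nat.eq_dec J (S N)); [assumption|exfalso].
        specialize (H2 N ltac:(lia)). specialize (Hv N ltac:(lia)). lra. }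
      subst J. exists (S (S N)). repeat split; [lia| |lia].
      intros j Hj. destruct (Nat.eq_dec j (S N)) as [->|]; [assumption|].
      apply H1; lia.
    + exists J. repeat split; [lia|assumption|].
      intros j Hj. destruct (Nat.eq_dec j (S N)) as [->|]; [assumption|].
      apply H2; lia.
Qed.

(** A function [F i] with [~ D i] is a unit step at [s i]; it separates the
    functions before it, constant to the right of [s i], from those after it,
    which vanish to the left. *)
Lemma few_oscillations_split (F : nat -> R -> R) (D : nat -> Prop) (s : nat -> R)
  (Hleft : forall i, ~ D i -> forall i' u, (i <= i')%nat -> u < s i -> F i' u = 0)
  (Hright : forall i, ~ D i -> forall i' u, (i' <= i)%nat -> s i <= u -> F i' u = 1)
  (HD : forall p w c, (forall i, (p <= i < p + w)%nat -> D i) ->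
     ~ oscillates (fun u => rsum (fun i => c i * F i u) p w) (S w)) :
  few_oscillations F.
Proof.
  intros p w. revert p.
  induction w as [w IH] using lt_wf_ind. intros p c.
  destruct (classic (forall i, (p <= i < p + w)%nat -> D i)) as [Hall|Hex];
    [now apply HD|].
  (* A unit step at index [p + a] cuts the [w] functions into [a] before it and [b] after it. *)
  assert (Hi : exists a b, w = (a + (1 + b))%nat /\ ~ D (p + a)%nat).
  { apply not_all_ex_not in Hex as [i Hi]. apply imply_to_and in Hi as [Hi Hd].
    exists (i - p)%nat, (p + w - i - 1)%nat. split; [lia|].
    now replace (p + (i - p))%nat with i by lia. }
  destruct Hi as [a [b [-> Hd]]].
  intros [sg [v Hv]].
  destruct (increasing_threshold v (s (p + a)%nat) (S (a + (1 + b)))) as [J [HJ [H1 H2]]].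
  { intros j Hj. now apply Hv. }
  assert (Hsum : forall u, rsum (fun i => c i * F i u) p (a + (1 + b)) =
    rsum (fun i => c i * F i u) p a + c (p + a)%nat * F (p + a)%nat u
    + rsum (fun i => c i * F i u) (p + a + 1) b).
  { intros u. rewrite !rsum_app. simpl. rewrite Nat.add_0_r. lra. }
  (* The first [J] sample points lie left of the step, where only the first [a] functions survive;
     their [J - 1] increments obey the induction hypothesis. *)
  assert (HA : (J - 1 <= a)%nat).
  { destruct (Nat.le_gt_cases (J - 1) a) as [|Hlt]; [assumption|exfalso].
    apply (IH a ltac:(lia) p c). apply (oscillates_le _ (J - 1 - 0)); [lia|].
    apply (oscillates_ext (fun u => rsum (fun i => c i * F i u) p (a + (1 + b)))
             _ 0 sg v).
    - intros j Hj. apply Hv. lia.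
    - intros j Hj. rewrite Hsum.
      rewrite (Hleft _ Hd (p + a)%nat) by (try apply H1; lia).
      rewrite (rsum_zero _ (p + a + 1)); [lra|].
      intros i Hi. rewrite (Hleft _ Hd i) by (try apply H1; lia). lra. }
  (* From the point [J] on, the first [a] functions and the step are all 1, so they contribute a
     constant. *)
  assert (HB : (S (a + (1 + b)) - J <= b)%nat).
  { destruct (Nat.le_gt_cases (S (a + (1 + b)) - J) b) as [|Hlt]; [assumption|exfalso].
    apply (IH b ltac:(lia) (p + a + 1)%nat c).
    apply (oscillates_le _ (S (a + (1 + b)) - J)); [lia|].
    apply (oscillates_ext (fun u => rsum (fun i => c i * F i u) p (a + (1 + b)))
             _ (rsum c p a + c (p + a)%nat) sg v).
    - intros j Hj. apply Hv. lia.
    - intros j Hj. rewrite Hsum.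
      rewrite (Hright _ Hd (p + a)%nat) by (try apply H2; lia).
      rewrite (rsum_ext (fun i => c i * F i (v j)) c p a); [lra|].
      intros i Hi. rewrite (Hright _ Hd i) by (try apply H2; lia). lra. }
  (* Only one increment straddles the step, so at most [a + b + 1 = w] increments are available, one
     too few. *)
  lia.
Qed.

(** * Integrals of functions vanishing outside an interval *)

Lemma RInt_gen_minfty_point (f : R -> R) (a u l : R) :
  (forall x, x < a -> is_RInt f x u l) ->
  RInt_gen f (Rbar_locally m_infty) (at_point u) = l.
Proof.
  intros H. apply is_RInt_gen_unique. intros P HP.
  apply (Filter_prod _ _ _ (fun x => x < a) (fun y => y = u)).
  - exists a. auto.
  - reflexivity.
  - intros x y Hx ->. exists l. split; [now apply H|]. now apply locally_singleton.
Qed.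

Lemma RInt_gen_minfty_pinfty (f : R -> R) (a b l : R) :
  (forall x y, x < a -> b < y -> is_RInt f x y l) ->
  RInt_gen f (Rbar_locally m_infty) (Rbar_locally p_infty) = l.
Proof.
  intros H. apply is_RInt_gen_unique. intros P HP.
  apply (Filter_prod _ _ _ (fun x => x < a) (fun y => b < y)).
  - exists a. auto.
  - exists b. auto.
  - intros x y Hx Hy. exists l. split; [now apply H|]. now apply locally_singleton.
Qed.

Lemma is_RInt_zero (f : R -> R) (x y : R) :
  (forall u, Rmin x y < u < Rmax x y -> f u = 0) -> is_RInt f x y 0.
Proof.
  intros H. apply (is_RInt_ext (fun _ => 0)).
  - intros u Hu. now rewrite H.
  - pose proof (is_RInt_const x y (0 : R)) as Hc.
    unfold scal in Hc; simpl in Hc; unfold mult in Hc; simpl in Hc.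
    now rewrite Rmult_0_r in Hc.
Qed.

Definition clamp (a b u : R) : R := Rmax a (Rmin u b).

Lemma is_RInt_supported (f : R -> R) (a b x u : R) :
  a <= b -> ex_RInt f a b -> (forall v, v < a \/ b < v -> f v = 0) ->
  x < a -> is_RInt f x u (RInt f a (clamp a b u)).
Proof.
  intros Hab Hf H0 Hx. unfold clamp.
  assert (Hxa : is_RInt f x a 0).
  { apply is_RInt_zero. rewrite Rmin_left, Rmax_right by lra. intros v Hv.
    apply H0. lra. }
  destruct (Rle_lt_dec u a) as [Hu|Hu]; [|destruct (Rle_lt_dec u b) as [Hub|Hub]].
  - rewrite Rmax_left by (pose proof (Rmin_l u b); lra).
    rewrite RInt_point. apply is_RInt_zero. intros v [_ Hv]. apply H0. left.
    apply Rlt_le_trans with (1 := Hv). now apply Rmax_lub; [lra|].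
  - rewrite Rmin_left, Rmax_right by lra.
    rewrite <- (Rplus_0_l (RInt f a u)). apply (is_RInt_Chasles f x a u); [assumption|].
    apply (RInt_correct f). now apply (ex_RInt_Chasles_1 f a u b); [lra|].
  - rewrite (Rmin_right u b), Rmax_right by lra.
    rewrite <- (Rplus_0_l (RInt f a b)). apply (is_RInt_Chasles f x a u); [assumption|].
    rewrite <- (Rplus_0_r (RInt f a b)). apply (is_RInt_Chasles f a b u).
    + now apply (RInt_correct f).
    + apply is_RInt_zero. rewrite Rmin_left, Rmax_right by lra. intros v Hv.
      apply H0. lra.
Qed.

Lemma clamp_bounds (a b u : R) : a <= b -> a <= clamp a b u <= b.
Proof.
  intros H. unfold clamp. split; [apply Rmax_l|].
  apply Rmax_lub; [assumption|apply Rmin_r].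
Qed.

Lemma clamp_id (a b u : R) : a <= u <= b -> clamp a b u = u.
Proof. intros H. unfold clamp. now rewrite Rmin_left, Rmax_right by lra. Qed.

Lemma clamp_between (a b u v x : R) :
  a <= b -> u < v -> clamp a b u < x < clamp a b v -> u < x < v.
Proof.
  unfold clamp, Rmax, Rmin. intros H H1 H2.
  destruct (Rle_dec u b), (Rle_dec v b); repeat destruct Rle_dec; lra.
Qed.

Lemma clamp_le (a b u v : R) : a <= b -> u <= v -> clamp a b u <= clamp a b v.
Proof.
  unfold clamp, Rmax, Rmin. intros H H1.
  destruct (Rle_dec u b), (Rle_dec v b); repeat destruct Rle_dec; lra.
Qed.

(** Otherwise [sigma * f] would be nonpositive inside the interval, and so would its integral. This
    replaces the mean value theorem, as [f] may be discontinuous. *)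
Lemma is_RInt_pos_witness (f : R -> R) (x y l sigma : R) :
  x <= y -> is_RInt f x y l -> 0 < sigma * l ->
  exists u, x < u < y /\ 0 < sigma * f u.
Proof.
  intros Hxy Hf Hl. apply NNPP. intros Hn.
  enough (sigma * l <= 0) by lra.
  apply (is_RInt_le (fun u => sigma * f u) (fun _ => 0) x y).
  - assumption.
  - now apply (is_RInt_scal f x y sigma l).
  - now apply is_RInt_zero.
  - intros u Hu. destruct (Rle_lt_dec (sigma * f u) 0); [assumption|].
    exfalso. apply Hn. now exists u.
Qed.

Lemma is_RInt_rsum (F : nat -> R -> R) (l : nat -> R) (x y : R) (p w : nat) :
  (forall i, (p <= i < p + w)%nat -> is_RInt (F i) x y (l i)) ->
  is_RInt (fun u => rsum (fun i => F i u) p w) x y (rsum l p w).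
Proof.
  induction w as [|w IH]; intros H; simpl.
  - now apply is_RInt_zero.
  - apply (is_RInt_plus (fun u => rsum (fun i => F i u) p w) (F (p + w)%nat)).
    + apply IH. intros i Hi. apply H. lia.
    + apply H. lia.
Qed.

Lemma is_derive_rsum (F : nat -> R -> R) (l : nat -> R) (u : R) (p w : nat) :
  (forall i, (p <= i < p + w)%nat -> is_derive (F i) u (l i)) ->
  is_derive (fun u => rsum (fun i => F i u) p w) u (rsum l p w).
Proof.
  induction w as [|w IH]; intros H; simpl.
  - apply (is_derive_const (0 : R)).
  - apply (is_derive_plus (fun u => rsum (fun i => F i u) p w) (F (p + w)%nat)).
    + apply IH. intros i Hi. apply H. lia.
    + apply H. lia.
Qed.

(** * Induction on the level *)

(** [cumul M (n + 1) i] is the integral of [delta_{i,n} N_{i,n}] over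
    (-oo, u]; at level 0 every N_{i,-1} counts as undefined. *)
Definition cumul (M : mdspace) (n i : nat) : R -> R :=
  match n with
  | O => fun u => if Rle_dec (sknot M i) u then 1 else 0
  | S n' => mdb_cumul M n' i (mdb M n' i)
  end.

(** Sum over the indices [i] with [supported M n i h]. *)
Definition supp_sum (M : mdspace) (n h : nat) (f : nat -> R) : R :=
  rsum f (Tcount M h + max_deg M + 1 - n) (n + deg M h + 1 - max_deg M).

Lemma supported_iff (M : mdspace) (HM : valid_mdspace M) (n h i : nat) :
  (n <= max_deg M)%nat -> (h <= nbk M)%nat ->
  supported M n i h <->
  (Tcount M h + max_deg M + 1 - n <= i <
   Tcount M h + max_deg M + 1 - n + (n + deg M h + 1 - max_deg M))%nat.
Proof.
  intros Hn Hh. unfold supported. pose proof (Lcount_Tcount M HM h Hh). lia.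
Qed.

(** What is known about the [C_{i,n-1}], from which level [n] is built. Unit steps jump at
    breakpoints, hence continuity only cell by cell, through an extension [g]. The last bound in
    [ok_one] says that the support of [N_{i,n-1}], if there is one, ends by [x_h]. *)
Record level_ok (M : mdspace) (n : nat) : Prop := {
  ok_cont : forall i h, (h <= nbk M)%nat -> exists g : R -> R,
    (forall x, continuous g x) /\ forall u, in_cell M h u -> cumul M n i u = g u;
  ok_zero : forall i h u, in_cell M h u -> (Lcount M h < i)%nat -> cumul M n i u = 0;
  ok_one : forall i h u, in_cell M h u -> (i <= Lcount M h)%nat ->
    (i + n <= Tcount M h + max_deg M + 1)%nat -> cumul M n i u = 1;
  ok_before : forall i u, u < left_end M -> cumul M n i u = 0;
  ok_after : forall i u, right_end M <= u -> cumul M n i u = 1;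
  ok_osc : few_oscillations (cumul M n)
}.

Definition cellwise_indep (M : mdspace) (n : nat) : Prop :=
  forall (h : nat) (c : nat -> R), (h <= nbk M)%nat -> active M n h ->
    (forall u, bkpt M h < u < bkpt M (h + 1) ->
       supp_sum M n h (fun i => c i * mdb M n i u) = 0) ->
    forall i, supported M n i h -> c i = 0.

(** Extends the recurrence beyond its defining case: outside the support both terms are 0 or both
    are 1, and where [N_{i,n}] is set to 1 they are 1 and 0. On an inactive cell the difference
    would be 1 at [i = Lcount M h], although [N_{i,n}] is 0 there. *)
Lemma mdb_cumul_diff (M : mdspace) (HM : valid_mdspace M) (n : nat)
  (Hn : level_ok M n) (h i : nat) (u : R) :
  in_cell M h u -> active M n h -> (max_deg M + 1 <= i + n)%nat ->
  mdb M n i u = cumul M n i u - cumul M n (i + 1) u.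
Proof.
  intros Hu Ha Hi. unfold active in Ha.
  pose proof (Lcount_Tcount M HM h (proj1 Hu)) as HL.
  pose proof (deg_le_max M h (proj1 Hu)) as Hd.
  destruct (classic (supported M n i h)) as [Hs|Hs].
  - destruct (Nat.eq_dec n (max_deg M - deg M h)) as [He|He].
    (* At the first level active on the cell, [supported] leaves only [i = Lcount M h]. *)
    + rewrite (mdb_top M HM n i h u Hu Hs He). unfold supported in Hs.
      rewrite (ok_one M n Hn i h u), (ok_zero M n Hn (i + 1) h u) by (auto; lia). lra.
    + destruct n as [|n]; [lia|].
      now rewrite (mdb_rec M HM n i h u Hu Hs) by lia.
  - rewrite (mdb_unsupported M HM n i h u Hu Hs). unfold supported in Hs.
    destruct (Nat.le_gt_cases i (Lcount M h)) as [Hle|Hgt].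
    + rewrite (ok_one M n Hn i h u), (ok_one M n Hn (i + 1) h u) by (auto; lia). lra.
    + rewrite (ok_zero M n Hn i h u), (ok_zero M n Hn (i + 1) h u) by (auto; lia). lra.
Qed.

(** * Integrability, sign and total integral at one level *)

Lemma mdb_cell_continuous (M : mdspace) (HM : valid_mdspace M) (n : nat)
  (Hn : level_ok M n) (i h : nat) :
  (h <= nbk M)%nat -> exists g : R -> R,
    (forall x, continuous g x) /\ forall u, in_cell M h u -> mdb M n i u = g u.
Proof.
  intros Hh. destruct (classic (supported M n i h)) as [Hs|Hs].
  - pose proof (supported_active M HM n i h Hh Hs) as Ha.
    pose proof (supported_defined M HM n i h Hh Hs) as [Hi _].
    destruct (ok_cont M n Hn i h Hh) as [g [Hg Eg]].
    destruct (ok_cont M n Hn (i + 1) h Hh) as [k [Hk Ek]].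
    exists (fun u => g u - k u). split.
    + intros x. now apply (continuous_minus g k).
    + intros u Hu. rewrite (mdb_cumul_diff M HM n Hn h i u) by assumption.
      now rewrite Eg, Ek.
  - exists (fun _ => 0). split.
    + intros x. apply continuous_const.
    + intros u Hu. now apply (mdb_unsupported M HM n i h).
Qed.

Lemma mdb_integrable (M : mdspace) (HM : valid_mdspace M) (n : nat)
  (Hn : level_ok M n) (i : nat) :
  ex_RInt (mdb M n i) (left_end M) (right_end M).
Proof.
  assert (H : forall p, (p <= nbk M + 1)%nat ->
    ex_RInt (mdb M n i) (left_end M) (bkpt M p)).
  { induction p as [|p IH]; intros Hp; [apply ex_RInt_point|].
    apply (ex_RInt_Chasles _ _ (bkpt M p)); [apply IH; lia|].
    destruct (mdb_cell_continuous M HM n Hn i p ltac:(lia)) as [g [Hg Eg]].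
    pose proof (bkpt_lt_succ M HM p ltac:(lia)) as Hx.
    replace (p + 1)%nat with (S p) in Hx by lia.
    apply (ex_RInt_ext g).
    - rewrite Rmin_left, Rmax_right by lra. intros x Hx'. symmetry. apply Eg.
      split; [lia|]. replace (p + 1)%nat with (S p) by lia. lra.
    - apply (ex_RInt_continuous (V := R_CompleteNormedModule)). intros z _. apply Hg. }
  apply H. lia.
Qed.

Lemma ends_lt (M : mdspace) (HM : valid_mdspace M) : left_end M < right_end M.
Proof.
  apply (Rle_lt_trans _ (bkpt M (nbk M))); [apply bkpt_le; auto; lia|].
  apply (bkpt_lt_succ M HM). lia.
Qed.

(** Adjoining a point left of [a] and the point [b], where the combination of the [cumul] is 0,
    turns [w + 1] alternating values into [w + 2] alternating increments of a combination of [w + 1]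
    functions, which [ok_osc] forbids. *)
Lemma mdb_no_alternation (M : mdspace) (HM : valid_mdspace M) (n : nat)
  (Hn : level_ok M n) (p w : nat) (c : nat -> R) (sigma : R) (u : nat -> R) :
  (forall i, (p <= i < p + w)%nat -> (max_deg M + 1 <= i + n)%nat) ->
  (forall j, (j <= w)%nat -> left_end M < u j < right_end M /\
     0 < sigma * (-1) ^ j * rsum (fun i => c i * mdb M n i (u j)) p w) ->
  (forall j, (j < w)%nat -> u j < u (S j)) -> False.
Proof.
  intros Hi Hu Hinc.
  destruct (rsum_differences c p w) as [e He].
  set (F := fun x => rsum (fun i => e i * cumul M n i x) p (S w)).
  (* The difference formula is available at each [u j]: on an inactive cell all the [mdb] vanish,
     against the strict inequality. *)
  assert (HF : forall j, (j <= w)%nat ->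
    rsum (fun i => c i * mdb M n i (u j)) p w = F (u j)).
  { intros j Hj. destruct (Hu j Hj) as [Hab Hpos].
    destruct (in_cell_exists M (u j) ltac:(lra)) as [h Hh].
    destruct (classic (active M n h)) as [Ha|Ha].
    - unfold F. rewrite <- (He (fun i => cumul M n i (u j))). apply rsum_ext.
      intros i Hr. rewrite (mdb_cumul_diff M HM n Hn h) by auto. reflexivity.
    - exfalso. rewrite rsum_zero in Hpos; [lra|]. intros i _.
      rewrite (mdb_unsupported M HM n i h (u j) Hh); [lra|].
      intros Hs. apply Ha. now apply (supported_active M HM n i h (proj1 Hh)). }
  assert (HF0 : F (left_end M - 1) = 0).
  { apply rsum_zero. intros i _. rewrite (ok_before M n Hn) by lra. lra. }
  assert (HF1 : F (right_end M) = 0).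
  { unfold F. rewrite <- (He (fun i => cumul M n i (right_end M))).
    apply rsum_zero. intros i _. rewrite !(ok_after M n Hn) by lra. lra. }
  apply (ok_osc M n Hn p (S w) e). fold F.
  exists sigma, (fun j => match j with O => left_end M - 1
    | S j' => if Nat.leb j' w then u j' else right_end M end).
  intros j Hj. destruct j as [|j]; cbv beta iota.
  - rewrite (proj2 (Nat.leb_le 0 w)),  HF0, <- HF by lia.
    destruct (Hu 0%nat ltac:(lia)) as [H1 H2]. split; lra.
  - replace (Nat.leb j w) with true by (symmetry; apply Nat.leb_le; lia).
    destruct (Hu j ltac:(lia)) as [H1 H2]. rewrite HF in H2 by lia.
    destruct (Nat.eq_dec j w) as [->|Hne].
    + replace (Nat.leb (S w) w) with false by (symmetry; apply Nat.leb_gt; lia).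
      rewrite HF1. split; [lra|]. rewrite <- tech_pow_Rmult. lra.
    + replace (Nat.leb (S j) w) with true by (symmetry; apply Nat.leb_le; lia).
      destruct (Hu (S j) ltac:(lia)) as [H3 H4]. rewrite HF in H4 by lia.
      split; [apply Hinc; lia|]. rewrite <- tech_pow_Rmult in *. lra.
Qed.

(** A change of sign would be two alternating values of a single function, excluded by
    [mdb_no_alternation] with [w = 1]; a nonzero value persists on a short interval by continuity on
    the cell and makes the integral nonzero. *)
Lemma mdb_integral_nonzero (M : mdspace) (HM : valid_mdspace M) (n : nat)
  (Hn : level_ok M n) (Hind : cellwise_indep M n) (i : nat) :
  mdb_defined M n i -> RInt (mdb M n i) (left_end M) (right_end M) <> 0.
Proof.
  intros Hdef.
  destruct (mdb_defined_supported M HM n i Hdef) as [h [Hh Hs]].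
  pose proof (supported_active M HM n i h Hh Hs) as Ha.
  assert (Hnz : exists u, bkpt M h < u < bkpt M (h + 1) /\ mdb M n i u <> 0).
  { apply NNPP. intros Hno.
    enough ((fun r => if Nat.eqb r i then 1 else 0) i = 0) as H.
    { simpl in H. rewrite Nat.eqb_refl in H. lra. }
    apply (Hind h (fun r => if Nat.eqb r i then 1 else 0)); try assumption.
    intros u Hu. apply rsum_zero. intros r _.
    destruct (Nat.eqb_spec r i) as [->|]; [|lra].
    destruct (Req_dec (mdb M n i u) 0) as [->|Hne]; [lra|].
    exfalso. apply Hno. now exists u. }
  destruct Hnz as [u0 [Hu0 Hne]].
  set (sg := mdb M n i u0).
  assert (Hpos0 : 0 < sg * mdb M n i u0) by (apply Rsqr_pos_lt, Hne).
  assert (Hab : left_end M < u0 < right_end M).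
  { split.
    - apply Rle_lt_trans with (bkpt M h); [apply bkpt_le; auto; lia|lra].
    - apply Rlt_le_trans with (bkpt M (h + 1)); [lra|apply bkpt_le; auto; lia]. }
  assert (Hsign : forall u, left_end M < u < right_end M -> 0 <= sg * mdb M n i u).
  { intros u Hu. apply Rnot_lt_le. intros Hneg.
    assert (Hsum : forall x, rsum (fun r => 1 * mdb M n r x) i 1 = mdb M n i x).
    { intros x. simpl. rewrite Nat.add_0_r. lra. }
    assert (Hi : forall r, (i <= r < i + 1)%nat -> (max_deg M + 1 <= r + n)%nat).
    { intros r Hr. destruct Hdef as [Hd _]. lia. }
    destruct (Rtotal_order u0 u) as [Hlt|[Heq|Hgt]].
    - apply (mdb_no_alternation M HM n Hn i 1 (fun _ => 1) sg
        (fun j => match j with O => u0 | _ => u end) Hi).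
      + intros [|[|j]] Hj; [| |lia]; cbv beta iota; rewrite Hsum; split;
          try assumption; simpl; lra.
      + intros [|j] Hj; [assumption|lia].
    - subst u. lra.
    - apply (mdb_no_alternation M HM n Hn i 1 (fun _ => 1) (- sg)
        (fun j => match j with O => u | _ => u0 end) Hi).
      + intros [|[|j]] Hj; [| |lia]; cbv beta iota; rewrite Hsum; split;
          try assumption; simpl; lra.
      + intros [|j] Hj; [assumption|lia]. }
  destruct (mdb_cell_continuous M HM n Hn i h Hh) as [g [Hg Eg]].
  assert (Hloc : locally u0 (fun x => 0 < sg * g x)).
  { apply (continuous_scal_r sg g u0 (Hg u0)). apply open_gt.
    unfold scal; simpl; unfold mult; simpl.
    rewrite <- Eg; [assumption|split; [assumption|lra]]. }
  destruct Hloc as [eps Heps].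
  pose (y := u0 + Rmin (eps / 2) ((bkpt M (h + 1) - u0) / 2)).
  pose proof (cond_pos eps) as He.
  pose proof (Rmin_l (eps / 2) ((bkpt M (h + 1) - u0) / 2)).
  pose proof (Rmin_r (eps / 2) ((bkpt M (h + 1) - u0) / 2)).
  assert (0 < Rmin (eps / 2) ((bkpt M (h + 1) - u0) / 2)) by (apply Rmin_pos; lra).
  assert (Hy : u0 < y < bkpt M (h + 1)) by (unfold y; lra).
  assert (Hyb : bkpt M (h + 1) <= right_end M) by (apply bkpt_le; auto; lia).
  assert (HI : forall x z, left_end M <= x <= z -> z <= right_end M ->
    ex_RInt (fun v => sg * mdb M n i v) x z).
  { intros x z Hx Hz. apply (ex_RInt_scal (mdb M n i) x z sg).
    apply (ex_RInt_Chasles_2 (V := R_CompleteNormedModule) _ (left_end M)); [lra|].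
    apply (ex_RInt_Chasles_1 (V := R_CompleteNormedModule) _ _ _ (right_end M)); [lra|].
    now apply mdb_integrable. }
  intros HI0.
  assert (Hz : RInt (fun v => sg * mdb M n i v) (left_end M) (right_end M) = 0).
  { rewrite (RInt_scal (mdb M n i)) by now apply mdb_integrable.
    rewrite HI0. apply Rmult_0_r. }
  rewrite <- (RInt_Chasles _ _ u0) in Hz by (apply HI; lra).
  rewrite <- (RInt_Chasles _ u0 y) in Hz by (apply HI; lra).
  unfold plus in Hz; simpl in Hz.
  assert (0 <= RInt (fun v => sg * mdb M n i v) (left_end M) u0).
  { apply RInt_ge_0; [lra|apply HI; lra|]. intros x Hx. apply Hsign. lra. }
  assert (0 <= RInt (fun v => sg * mdb M n i v) y (right_end M)).
  { apply RInt_ge_0; [lra|apply HI; lra|]. intros x Hx. apply Hsign. lra. }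
  assert (0 < RInt (fun v => sg * mdb M n i v) u0 y).
  { rewrite (RInt_ext _ (fun v => sg * g v)).
    - apply RInt_gt_0; [lra| |].
      + intros x Hx. apply Heps. unfold ball; simpl; unfold AbsRing_ball, abs, minus,
          plus, opp; simpl. apply Rabs_def1; unfold y in Hx; lra.
      + intros x _. apply (continuous_scal_r sg g x (Hg x)).
    - rewrite Rmin_left, Rmax_right by lra. intros x Hx.
      rewrite Eg; [reflexivity|]. split; [assumption|lra]. }
  lra.
Qed.

(** * Normalised integrals at the next level *)

(** Its inverse is [delta_{i,n}]: as [N_{i,n}] vanishes outside [[a,b]], the integral over the line
    reduces to this one. *)
Definition mdb_integral (M : mdspace) (n i : nat) : R :=
  RInt (mdb M n i) (left_end M) (right_end M).

Lemma cumul_defined (M : mdspace) (HM : valid_mdspace M) (n : nat)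
  (Hn : level_ok M n) (i : nat) (u : R) :
  mdb_defined M n i ->
  cumul M (S n) i u =
  RInt (mdb M n i) (left_end M) (clamp (left_end M) (right_end M) u)
  / mdb_integral M n i.
Proof.
  intros Hdef. simpl. unfold mdb_cumul.
  destruct excluded_middle_informative as [_|]; [|contradiction].
  pose proof (ends_lt M HM) as Hab.
  assert (Hsupp : forall x v, x < left_end M -> is_RInt (mdb M n i) x v
    (RInt (mdb M n i) (left_end M) (clamp (left_end M) (right_end M) v))).
  { intros x v Hx. apply is_RInt_supported; try lra.
    - now apply mdb_integrable.
    - intros z Hz. now apply mdb_outside. }
  assert (Hd : mdb_delta (mdb M n i) = / mdb_integral M n i).
  { unfold mdb_delta. f_equal.
    apply (RInt_gen_minfty_pinfty _ (left_end M) (right_end M)).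
    intros x y Hx Hy. specialize (Hsupp x y Hx).
    unfold clamp in Hsupp. rewrite Rmin_right, Rmax_right in Hsupp by lra.
    exact Hsupp. }
  apply (RInt_gen_minfty_point _ (left_end M)). intros x Hx.
  rewrite Hd. unfold Rdiv. rewrite Rmult_comm.
  now apply (is_RInt_scal (mdb M n i)), Hsupp.
Qed.

Lemma cumul_undefined (M : mdspace) (n i : nat) (u : R) :
  ~ mdb_defined M n i ->
  cumul M (S n) i u = if Rle_dec (sknot M i) u then 1 else 0.
Proof.
  intros H. simpl. unfold mdb_cumul.
  now destruct excluded_middle_informative.
Qed.

Lemma cumul_increment (M : mdspace) (HM : valid_mdspace M) (n : nat)
  (Hn : level_ok M n) (i : nat) (u v : R) :
  mdb_defined M n i -> u < v ->
  is_RInt (fun x => / mdb_integral M n i * mdb M n i x)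
    (clamp (left_end M) (right_end M) u) (clamp (left_end M) (right_end M) v)
    (cumul M (S n) i v - cumul M (S n) i u).
Proof.
  intros Hdef Huv. pose proof (ends_lt M HM) as Hab.
  rewrite !(cumul_defined M HM n Hn i) by assumption.
  pose proof (clamp_bounds (left_end M) (right_end M) u ltac:(lra)).
  pose proof (clamp_bounds (left_end M) (right_end M) v ltac:(lra)).
  pose proof (clamp_le (left_end M) (right_end M) u v ltac:(lra) ltac:(lra)).
  set (x := clamp _ _ u) in *. set (y := clamp _ _ v) in *.
  pose proof (mdb_integrable M HM n Hn i) as HI.
  assert (Hx : ex_RInt (mdb M n i) (left_end M) x).
  { apply (ex_RInt_Chasles_1 (V := R_CompleteNormedModule) _ _ _ (right_end M)); [lra|assumption]. }
  assert (Hy : ex_RInt (mdb M n i) x y).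
  { apply (ex_RInt_Chasles_2 (V := R_CompleteNormedModule) _ (left_end M)); [lra|].
    apply (ex_RInt_Chasles_1 (V := R_CompleteNormedModule) _ _ _ (right_end M)); [lra|assumption]. }
  rewrite <- (RInt_Chasles (mdb M n i) _ x y) by assumption. unfold plus; simpl.
  replace (_ - _) with (/ mdb_integral M n i * RInt (mdb M n i) x y)
    by (unfold Rdiv; ring).
  apply (is_RInt_scal (mdb M n i)). now apply (RInt_correct (mdb M n i)).
Qed.

(** With the continuous extension [g] in place of [N_{i,n}] as integrand, the fundamental theorem of
    calculus applies at every point, including the left end of the cell. *)
Lemma cumul_derive (M : mdspace) (HM : valid_mdspace M) (n : nat)
  (Hn : level_ok M n) (i h : nat) : (h <= nbk M)%nat -> mdb_defined M n i ->
  exists G : R -> R, (forall u, in_cell M h u -> cumul M (S n) i u = G u) /\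
    (forall u, continuous G u) /\
    (forall u, in_cell M h u -> is_derive G u (mdb M n i u / mdb_integral M n i)).
Proof.
  intros Hh Hdef. destruct (mdb_cell_continuous M HM n Hn i h Hh) as [g [Hg Eg]].
  pose proof (bkpt_lt_succ M HM h Hh) as Hx.
  set (x0 := bkpt M h).
  assert (HG : forall u, is_derive (fun u => cumul M (S n) i x0
    + / mdb_integral M n i * RInt g x0 u) u (/ mdb_integral M n i * g u)).
  { intros u. rewrite <- (Rplus_0_l (_ * g u)).
    apply (is_derive_plus (fun _ => cumul M (S n) i x0)).
    - apply (is_derive_const (cumul M (S n) i x0)).
    - apply (is_derive_scal (fun u => RInt g x0 u)).
      apply (is_derive_RInt g (fun u => RInt g x0 u) x0 u).
      + apply filter_forall. intros y. apply (RInt_correct g).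
        apply (ex_RInt_continuous (V := R_CompleteNormedModule)). intros z _. apply Hg.
      + apply Hg. }
  exists (fun u => cumul M (S n) i x0 + / mdb_integral M n i * RInt g x0 u).
  split; [|split].
  - intros u Hu. destruct (proj2 Hu) as [[Hlt|Heq] _]; [fold x0 in Hlt|fold x0 in Heq].
    + pose proof (in_cell_bounds M HM h u Hu).
      pose proof (in_cell_bounds M HM h x0 (conj Hh (conj (Rle_refl _) Hx))).
      pose proof (cumul_increment M HM n Hn i x0 u Hdef Hlt) as HI.
      rewrite !clamp_id in HI by lra.
      apply (is_RInt_ext _ (fun x => / mdb_integral M n i * g x)) in HI.
      * apply (is_RInt_unique (V := R_CompleteNormedModule)) in HI.
        rewrite (RInt_scal g) in HI
          by (apply ex_RInt_continuous; intros z _; apply Hg).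
        change (/ mdb_integral M n i * RInt g x0 u
          = cumul M (S n) i u - cumul M (S n) i x0) in HI. lra.
      * rewrite Rmin_left, Rmax_right by lra. intros x Hxx.
        rewrite Eg; [reflexivity|]. split; [assumption|]. unfold x0 in Hxx.
        pose proof (proj2 Hu). lra.
    + rewrite <- Heq, RInt_point. unfold zero; cbn -[cumul]. lra.
  - intros u. eapply (ex_derive_continuous (K := R_AbsRing) (V := R_NormedModule)).
    eexists. apply HG.
  - intros u Hu. rewrite Eg by assumption. unfold Rdiv. rewrite Rmult_comm. apply HG.
Qed.

Lemma cell_index_le (M : mdspace) (HM : valid_mdspace M) (h h' : nat) (u v : R) :
  in_cell M h u -> in_cell M h' v -> u <= v -> (h <= h')%nat.
Proof.
  intros [Hh Hu] [Hh' Hv] Huv. apply Nat.nlt_ge. intros Hlt.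
  pose proof (bkpt_le M HM (h' + 1) h ltac:(lia) ltac:(lia)). lra.
Qed.

Lemma cumul_S_before (M : mdspace) (HM : valid_mdspace M) (n : nat)
  (Hn : level_ok M n) (i : nat) (u : R) :
  u < left_end M -> cumul M (S n) i u = 0.
Proof.
  intros Hu. destruct (classic (mdb_defined M n i)) as [Hd|Hd].
  - rewrite (cumul_defined M HM n Hn i u Hd). pose proof (ends_lt M HM).
    unfold clamp. rewrite Rmin_left, Rmax_left, RInt_point by lra.
    apply Rmult_0_l.
  - rewrite (cumul_undefined M n i u Hd). pose proof (sknot_bounds M HM i).
    destruct Rle_dec; lra.
Qed.

Lemma cumul_S_after (M : mdspace) (HM : valid_mdspace M) (n : nat)
  (Hn : level_ok M n) (Hind : cellwise_indep M n) (i : nat) (u : R) :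
  right_end M <= u -> cumul M (S n) i u = 1.
Proof.
  intros Hu. destruct (classic (mdb_defined M n i)) as [Hd|Hd].
  - rewrite (cumul_defined M HM n Hn i u Hd). pose proof (ends_lt M HM).
    unfold clamp. rewrite Rmin_right, Rmax_right by lra.
    apply Rinv_r. now apply mdb_integral_nonzero.
  - rewrite (cumul_undefined M n i u Hd). pose proof (sknot_bounds M HM i).
    destruct Rle_dec; lra.
Qed.

(** Cells up to [h] have a [Lcount] below [i], so [N_{i,n}] vanishes on all of [[a,u]]. *)
Lemma cumul_S_zero (M : mdspace) (HM : valid_mdspace M) (n : nat)
  (Hn : level_ok M n) (i h : nat) (u : R) :
  in_cell M h u -> (Lcount M h < i)%nat -> cumul M (S n) i u = 0.
Proof.
  intros Hu Hi. destruct (classic (mdb_defined M n i)) as [Hd|Hd].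
  - rewrite (cumul_defined M HM n Hn i u Hd).
    pose proof (in_cell_bounds M HM h u Hu). rewrite clamp_id by lra.
    rewrite (is_RInt_unique (V := R_CompleteNormedModule) _ _ _ 0).
    + apply Rmult_0_l.
    + apply is_RInt_zero. rewrite Rmin_left, Rmax_right by lra. intros v Hv.
      destruct (in_cell_exists M v ltac:(lra)) as [h' Hh'].
      apply (mdb_unsupported M HM n i h' v Hh'). intros [Hs _].
      pose proof (cell_index_le M HM h' h v u Hh' Hu ltac:(lra)).
      pose proof (Lcount_le M h' h ltac:(lia)). lia.
  - rewrite (cumul_undefined M n i u Hd).
    destruct Rle_dec as [Hs|]; [|reflexivity].
    apply (sknot_le_iff M HM h i u Hu) in Hs. lia.
Qed.

(** [N_{i,n}] vanishes between [u] and [b], so the integral up to [u] is already the full one; it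
    normalises to 1 because it is nonzero. *)
Lemma cumul_S_one (M : mdspace) (HM : valid_mdspace M) (n : nat)
  (Hn : level_ok M n) (Hind : cellwise_indep M n) (i h : nat) (u : R) :
  in_cell M h u -> (i <= Lcount M h)%nat ->
  (i + S n <= Tcount M h + max_deg M + 1)%nat -> cumul M (S n) i u = 1.
Proof.
  intros Hu Hi Ht. destruct (classic (mdb_defined M n i)) as [Hd|Hd].
  - rewrite (cumul_defined M HM n Hn i u Hd).
    pose proof (in_cell_bounds M HM h u Hu). rewrite clamp_id by lra.
    pose proof (mdb_integrable M HM n Hn i) as HI.
    assert (H0 : RInt (mdb M n i) u (right_end M) = 0).
    { apply (is_RInt_unique (V := R_CompleteNormedModule)).
      apply is_RInt_zero. rewrite Rmin_left, Rmax_right by lra. intros v Hv.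
      destruct (in_cell_exists M v ltac:(lra)) as [h' Hh'].
      apply (mdb_unsupported M HM n i h' v Hh'). intros [_ Hs].
      pose proof (cell_index_le M HM h h' u v Hu Hh' ltac:(lra)).
      pose proof (Tcount_le M h h' ltac:(lia)). lia. }
    assert (Hau : mdb_integral M n i = RInt (mdb M n i) (left_end M) u).
    { unfold mdb_integral.
      rewrite <- (RInt_Chasles (mdb M n i) _ u (right_end M)), H0.
      - apply Rplus_0_r.
      - apply (ex_RInt_Chasles_1 (V := R_CompleteNormedModule) _ _ _ (right_end M));
          [lra|assumption].
      - apply (ex_RInt_Chasles_2 (V := R_CompleteNormedModule) _ (left_end M));
          [lra|assumption]. }
    rewrite <- Hau. apply Rinv_r. now apply mdb_integral_nonzero.
  - rewrite (cumul_undefined M n i u Hd).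
    destruct Rle_dec as [|Hs]; [reflexivity|].
    now apply (sknot_le_iff M HM h i u Hu) in Hi.
Qed.

Lemma cumul_step_continuous (M : mdspace) (HM : valid_mdspace M) (i h : nat) :
  exists g : R -> R, (forall x, continuous g x) /\
    forall u, in_cell M h u -> (if Rle_dec (sknot M i) u then 1 else 0) = g u.
Proof.
  exists (fun _ => if Nat.leb i (Lcount M h) then 1 else 0). split.
  - intros x. apply continuous_const.
  - intros u Hu. pose proof (sknot_le_iff M HM h i u Hu) as Hs.
    destruct (Nat.leb_spec i (Lcount M h)), Rle_dec; tauto || (exfalso; intuition lia).
Qed.

(** Each increment of a combination of defined [C_{i,n}] is an integral, so the combination of the
    [N_{i,n}] with rescaled coefficients takes a value of the same sign in between; [w + 1] such
    values would alternate. Undefined indices are unit steps, removed by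
    [few_oscillations_split]. *)
Lemma cumul_S_oscillations (M : mdspace) (HM : valid_mdspace M) (n : nat)
  (Hn : level_ok M n) (Hind : cellwise_indep M n) :
  few_oscillations (cumul M (S n)).
Proof.
  pose proof (ends_lt M HM) as Hab.
  apply (few_oscillations_split _ (mdb_defined M n) (sknot M)).
  - intros i Hd i' u Hi Hu. pose proof (sknot_bounds M HM i) as Hs.
    destruct (Rlt_le_dec u (left_end M)) as [H|H]; [now apply cumul_S_before|].
    destruct (in_cell_exists M u ltac:(lra)) as [h Hh].
    apply (cumul_S_zero M HM n Hn i' h u Hh).
    pose proof (proj2 (sknot_le_iff M HM h i u Hh)) as Hle.
    destruct (Nat.le_gt_cases i (Lcount M h)) as [Hc|]; [|lia].
    specialize (Hle Hc). lra.
  - intros i Hd i' u Hi Hu. pose proof (sknot_bounds M HM i) as Hs.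
    destruct (Rle_lt_dec (right_end M) u) as [H|H]; [now apply cumul_S_after|].
    destruct (in_cell_exists M u ltac:(lra)) as [h Hh].
    apply (sknot_le_iff M HM h i u Hh) in Hu.
    apply (cumul_S_one M HM n Hn Hind i' h u Hh); [lia|].
    (* If [t_{i-m+n}] were beyond the cell, [N_{i,n}] would be supported there and hence defined. *)
    apply Nat.nlt_ge. intros Ht. apply Hd.
    apply (supported_defined M HM n i h (proj1 Hh)). unfold supported. lia.
  - intros p w c Hall [sg [v Hv]].
    assert (Hu : forall j, {u : R | (j < S w)%nat -> v j < u < v (S j) /\
      left_end M < u < right_end M /\
      0 < sg * (-1) ^ j * rsum (fun i => c i / mdb_integral M n i * mdb M n i u) p w}).
    { intros j. apply constructive_indefinite_description.
      destruct (Nat.lt_ge_cases j (S w)) as [Hj|Hj]; [|exists 0; lia].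
      destruct (Hv j Hj) as [Hlt Hinc].
      (* Nothing accumulates outside [[a,b]], so the increment is carried by the clamped interval,
         and a witness inside it still lies between [v j] and [v (S j)]. *)
      set (x := clamp (left_end M) (right_end M) (v j)).
      set (y := clamp (left_end M) (right_end M) (v (S j))).
      assert (HI : is_RInt (fun u =>
          rsum (fun i => c i / mdb_integral M n i * mdb M n i u) p w) x y
          (rsum (fun i => c i * (cumul M (S n) i (v (S j)) - cumul M (S n) i (v j))) p w)).
      { apply (is_RInt_rsum (fun i u => c i / mdb_integral M n i * mdb M n i u)).
        intros i Hi.
        apply (is_RInt_ext (fun u => c i * (/ mdb_integral M n i * mdb M n i u))).
        - intros u _. symmetry. apply Rmult_assoc.
        - apply (is_RInt_scal (fun u => / mdb_integral M n i * mdb M n i u)).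
          now apply cumul_increment; [| |apply Hall|]. }
      rewrite (rsum_ext _ (fun i => c i * cumul M (S n) i (v (S j))
        - c i * cumul M (S n) i (v j))) in HI by (intros; ring).
      rewrite rsum_minus in HI.
      destruct (is_RInt_pos_witness _ x y _ _
        (clamp_le _ _ _ _ (Rlt_le _ _ Hab) (Rlt_le _ _ Hlt)) HI Hinc) as [u [Hxy Hpos]].
      exists u. intros _. split; [|split; [|assumption]].
      - now apply (clamp_between (left_end M) (right_end M)); [lra| |].
      - pose proof (clamp_bounds (left_end M) (right_end M) (v j) ltac:(lra)).
        pose proof (clamp_bounds (left_end M) (right_end M) (v (S j)) ltac:(lra)).
        unfold x, y in Hxy. lra. }
    apply (mdb_no_alternation M HM n Hn p w (fun i => c i / mdb_integral M n i) sg
      (fun j => proj1_sig (Hu j))).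
    + intros i Hi. apply (Hall i Hi).
    + intros j Hj. destruct (Hu j) as [u Hj']. simpl. apply Hj'. lia.
    + intros j Hj. destruct (Hu j) as [u Hj'], (Hu (S j)) as [u' Hj'']. simpl.
      specialize (Hj' ltac:(lia)). specialize (Hj'' ltac:(lia)). lra.
Qed.

(** * Linear independence on a cell *)

(** Summation by parts over the window at level [n + 1], which has one index more than the window at
    level [n]: on the cell the first [cumul] is 1 and the one past the end is 0. *)
Lemma supp_sum_abel (M : mdspace) (HM : valid_mdspace M) (n : nat)
  (Hn : level_ok M (S n)) (Hm : (S n <= max_deg M)%nat) (c : nat -> R)
  (h : nat) (u : R) :
  in_cell M h u -> active M n h ->
  supp_sum M (S n) h (fun i => c i * mdb M (S n) i u) =
  c (Tcount M h + max_deg M - n)%nat +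
  supp_sum M n h (fun i => (c i - c (i - 1)%nat) * cumul M (S n) i u).
Proof.
  intros Hu Ha. unfold active in Ha. unfold supp_sum.
  pose proof (Lcount_Tcount M HM h (proj1 Hu)) as HL.
  replace (Tcount M h + max_deg M + 1 - S n)%nat
    with (Tcount M h + max_deg M - n)%nat by lia.
  replace (S n + deg M h + 1 - max_deg M)%nat
    with (S (n + deg M h + 1 - max_deg M)) by lia.
  rewrite (rsum_ext _ (fun i => c i * (cumul M (S n) i u - cumul M (S n) (i + 1) u))).
  - rewrite (rsum_abel c (fun i => cumul M (S n) i u)).
    replace (S (Tcount M h + max_deg M - n))
      with (Tcount M h + max_deg M + 1 - n)%nat by lia.
    rewrite (ok_one M _ Hn _ h u Hu), (ok_zero M _ Hn _ h u Hu) by lia. lra.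
  - intros i Hi. rewrite (mdb_cumul_diff M HM (S n) Hn h i u); auto.
    + unfold active. lia.
    + lia.
Qed.

Lemma locally_open_interval (x y u : R) (P : R -> Prop) :
  x < u < y -> (forall v, x < v < y -> P v) -> locally u P.
Proof.
  intros Hu HP. apply (locally_interval P u x y); simpl; try tauto.
  intros v H1 H2. now apply HP.
Qed.

Lemma supp_sum_derive (M : mdspace) (HM : valid_mdspace M) (n : nat)
  (Hn : level_ok M n) (Hm : (n <= max_deg M)%nat) (d : nat -> R) (h : nat) (u : R) :
  (h <= nbk M)%nat -> bkpt M h < u < bkpt M (h + 1) ->
  is_derive (fun x => supp_sum M n h (fun i => d i * cumul M (S n) i x)) u
    (supp_sum M n h (fun i => d i / mdb_integral M n i * mdb M n i u)).
Proof.
  intros Hh Hu.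
  apply (is_derive_rsum (fun i x => d i * cumul M (S n) i x)).
  intros i Hi. apply (supported_iff M HM n h i Hm Hh) in Hi.
  apply (supported_defined M HM n i h Hh) in Hi.
  destruct (cumul_derive M HM n Hn i h Hh Hi) as [G [HG [_ Hd]]].
  replace (d i / mdb_integral M n i * mdb M n i u)
    with (d i * (mdb M n i u / mdb_integral M n i)) by (unfold Rdiv; ring).
  apply (is_derive_scal (cumul M (S n) i)).
  apply (is_derive_ext_loc G).
  - apply (locally_open_interval (bkpt M h) (bkpt M (h + 1))); [assumption|].
    intros x Hx. symmetry. apply HG. split; [assumption|lra].
  - apply Hd. split; [assumption|lra].
Qed.

(** At the first level active on the cell the sum has a single term, whose function is 1 there. *)
Lemma mdb_indep_fresh (M : mdspace) (HM : valid_mdspace M) (n h : nat) (c : nat -> R) :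
  (h <= nbk M)%nat -> (n + deg M h = max_deg M)%nat ->
  (forall u, bkpt M h < u < bkpt M (h + 1) ->
     supp_sum M n h (fun i => c i * mdb M n i u) = 0) ->
  forall i, supported M n i h -> c i = 0.
Proof.
  intros Hh Hn Hc i Hs. pose proof (bkpt_lt_succ M HM h Hh) as Hx.
  set (u := (bkpt M h + bkpt M (h + 1)) / 2).
  assert (Hu : bkpt M h < u < bkpt M (h + 1)) by (unfold u; lra).
  specialize (Hc u Hu). unfold supp_sum in Hc.
  replace (n + deg M h + 1 - max_deg M)%nat with 1%nat in Hc by lia.
  pose proof (proj1 (supported_iff M HM n h i ltac:(lia) Hh) Hs) as Hi.
  simpl in Hc. replace (Tcount M h + max_deg M + 1 - n + 0)%nat with i in Hc by lia.
  rewrite (mdb_top M HM n i h u) in Hc; [lra| |assumption|lia].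
  split; [assumption|lra].
Qed.

(** Differentiating a vanishing combination gives one at level [n] with coefficients
    [(c_i - c_{i-1}) delta_{i,n}], so all [c_i] in the window coincide; the constant left by the
    summation by parts is the first of them, and it is 0. *)
Lemma mdb_indep_S (M : mdspace) (HM : valid_mdspace M) (n : nat)
  (Hn : level_ok M n) (HSn : level_ok M (S n)) (Hind : cellwise_indep M n)
  (Hm : (S n <= max_deg M)%nat) : cellwise_indep M (S n).
Proof.
  intros h c Hh Ha Hc.
  destruct (classic (active M n h)) as [Ha'|Ha'].
  2: { apply mdb_indep_fresh; auto. unfold active in *. lia. }
  pose proof (bkpt_lt_succ M HM h Hh) as Hx.
  assert (Hstep : forall i, supported M n i h ->
    (c i - c (i - 1)%nat) / mdb_integral M n i = 0).
  { apply (Hind h (fun i => (c i - c (i - 1)%nat) / mdb_integral M n i));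
      try assumption.
    intros u Hu.
    pose proof (supp_sum_derive M HM n Hn ltac:(lia)
      (fun i => c i - c (i - 1)%nat) h u Hh Hu) as Hd.
    apply is_derive_unique in Hd. rewrite <- Hd. apply is_derive_unique.
    apply (is_derive_ext_loc (fun _ => - c (Tcount M h + max_deg M - n)%nat)).
    - apply (locally_open_interval (bkpt M h) (bkpt M (h + 1))); [assumption|].
      intros v Hv. specialize (Hc v Hv).
      rewrite (supp_sum_abel M HM n HSn Hm c h) in Hc
        by first [assumption | split; [assumption|lra]]. lra.
    - apply (is_derive_const (- c (Tcount M h + max_deg M - n)%nat)). }
  assert (Heq : forall i, supported M n i h -> c i - c (i - 1)%nat = 0).
  { intros i Hs. specialize (Hstep i Hs).
    apply Rmult_integral in Hstep as [|Hinv]; [assumption|exfalso].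
    revert Hinv. apply Rinv_neq_0_compat.
    apply (mdb_integral_nonzero M HM n Hn Hind).
    now apply (supported_defined M HM n i h). }
  assert (Hfirst : c (Tcount M h + max_deg M - n)%nat = 0).
  { set (u := (bkpt M h + bkpt M (h + 1)) / 2).
    assert (Hu : bkpt M h < u < bkpt M (h + 1)) by (unfold u; lra).
    specialize (Hc u Hu).
    rewrite (supp_sum_abel M HM n HSn Hm c h) in Hc
        by first [assumption | split; [assumption|lra]].
    unfold supp_sum in Hc. rewrite rsum_zero in Hc; [lra|].
    intros i Hi. rewrite Heq; [lra|]. apply supported_iff; auto; lia. }
  intros i Hs. apply supported_iff in Hs; auto.
  assert (Hall : forall k, (k < S n + deg M h + 1 - max_deg M)%nat ->
    c (Tcount M h + max_deg M - n + k)%nat = 0).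
  { induction k as [|k IH]; intros Hk.
    - now rewrite Nat.add_0_r.
    - specialize (Heq (Tcount M h + max_deg M - n + S k)%nat).
      replace (Tcount M h + max_deg M - n + S k - 1)%nat
        with (Tcount M h + max_deg M - n + k)%nat in Heq by lia.
      rewrite IH in Heq by lia.
      assert (Hsup : supported M n (Tcount M h + max_deg M - n + S k) h)
        by (apply supported_iff; auto; lia).
      specialize (Heq Hsup). lra. }
  replace i with (Tcount M h + max_deg M - n + (i - (Tcount M h + max_deg M - n)))%nat
    by lia.
  apply Hall. lia.
Qed.

Lemma level_ok_0 (M : mdspace) (HM : valid_mdspace M) : level_ok M 0.
Proof.
  pose proof (ends_lt M HM) as Hab. split; simpl.
  - intros i h _. now apply cumul_step_continuous.
  - intros i h u Hu Hi. destruct Rle_dec as [Hs|]; [|reflexivity].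
    apply (sknot_le_iff M HM h i u Hu) in Hs. lia.
  - intros i h u Hu Hi _. destruct Rle_dec as [|Hs]; [reflexivity|].
    now apply (sknot_le_iff M HM h i u Hu) in Hi.
  - intros i u Hu. pose proof (sknot_bounds M HM i). destruct Rle_dec; lra.
  - intros i u Hu. pose proof (sknot_bounds M HM i). destruct Rle_dec; lra.
  (* At level 0 every function is a unit step, so every index splits and only the empty sum is left
     to check. *)
  - apply (few_oscillations_split _ (fun _ => False) (sknot M)); simpl.
    + intros i _ i' u Hi Hu. destruct Rle_dec as [Hs|]; [|reflexivity].
      pose proof (sknot_mono M HM i i' Hi). lra.
    + intros i _ i' u Hi Hu. destruct Rle_dec as [|Hs]; [reflexivity|].
      pose proof (sknot_mono M HM i' i Hi). lra.
    + intros p w c Hall. destruct w as [|w]; [|now destruct (Hall p ltac:(lia))].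
      intros [sg [v Hv]]. destruct (Hv 0%nat ltac:(lia)) as [_ H]. simpl in H. lra.
Qed.

Lemma level_ok_S (M : mdspace) (HM : valid_mdspace M) (n : nat) :
  level_ok M n -> cellwise_indep M n -> level_ok M (S n).
Proof.
  intros Hn Hind. split.
  - intros i h Hh. destruct (classic (mdb_defined M n i)) as [Hd|Hd].
    + destruct (cumul_derive M HM n Hn i h Hh Hd) as [G [HG [Hc _]]]. now exists G.
    + destruct (cumul_step_continuous M HM i h) as [g [Hg Eg]]. exists g.
      split; [assumption|]. intros u Hu. rewrite cumul_undefined by assumption.
      now apply Eg.
  - intros. now apply (cumul_S_zero M HM n Hn i h).
  - intros. now apply (cumul_S_one M HM n Hn Hind i h).
  - intros. now apply cumul_S_before.
  - intros. now apply cumul_S_after.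
  - now apply cumul_S_oscillations.
Qed.

Lemma all_levels (M : mdspace) (HM : valid_mdspace M) (n : nat) :
  (n <= max_deg M)%nat -> level_ok M n /\ cellwise_indep M n.
Proof.
  induction n as [|n IH]; intros Hm.
  - split; [now apply level_ok_0|].
    intros h c Hh Ha. apply mdb_indep_fresh; auto.
    pose proof (deg_le_max M h Hh). unfold active in Ha. lia.
  - destruct (IH ltac:(lia)) as [Hn Hind].
    pose proof (level_ok_S M HM n Hn Hind) as HSn.
    split; [assumption|]. now apply (mdb_indep_S M HM n).
Qed.

(** * Basis functions and Greville abscissae on a cell *)

(** The differences of consecutive [cumul] telescope to the first, which is 1, minus the one past
    the end, which is 0. *)
Lemma mdb_partition_of_unity (M : mdspace) (HM : valid_mdspace M) (n : nat)
  (Hn : level_ok M n) (Hm : (n <= max_deg M)%nat) (h : nat) (u : R) :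
  in_cell M h u -> active M n h -> supp_sum M n h (fun i => mdb M n i u) = 1.
Proof.
  intros Hu Ha. unfold supp_sum.
  pose proof (Lcount_Tcount M HM h (proj1 Hu)) as HL.
  rewrite (rsum_ext _ (fun i => 1 * (cumul M n i u - cumul M n (i + 1) u))).
  - unfold active in Ha.
    replace (n + deg M h + 1 - max_deg M)%nat
      with (S (n + deg M h - max_deg M)) by lia.
    rewrite (rsum_abel (fun _ => 1) (fun i => cumul M n i u)).
    rewrite rsum_zero by (intros; lra).
    rewrite (ok_one M n Hn _ h u Hu), (ok_zero M n Hn _ h u Hu) by lia. lra.
  - intros i Hi. rewrite (mdb_cumul_diff M HM n Hn h i u); auto; [lra|lia].
Qed.

Lemma rsum_restrict (f : nat -> R) (p w q v : nat) :
  (q <= p)%nat -> (p + w <= q + v)%nat ->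
  (forall i, (q <= i < q + v)%nat -> ~ (p <= i < p + w)%nat -> f i = 0) ->
  rsum f q v = rsum f p w.
Proof.
  intros Hq Hv H.
  replace v with ((p - q) + (w + (q + v - (p + w))))%nat by lia.
  rewrite !rsum_app. replace (q + (p - q))%nat with p by lia.
  rewrite (rsum_zero f q), (rsum_zero f (p + w)); [lra| |];
    intros i Hi; apply H; lia.
Qed.

Lemma basis_sum_on_cell (M : mdspace) (HM : valid_mdspace M) (c : nat -> R)
  (h : nat) (u : R) : in_cell M h u ->
  rsum (fun i => c i * mdb_basis M i u) 1 (dimS M) =
  supp_sum M (max_deg M) h (fun i => c i * mdb M (max_deg M) i u).
Proof.
  intros Hu. pose proof (proj1 Hu) as Hh.
  pose proof (Lcount_Tcount M HM h Hh). pose proof (Lcount_le M h (nbk M) Hh).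
  rewrite dimS_Lcount. unfold supp_sum. apply rsum_restrict; try lia.
  intros i _ Hi. unfold mdb_basis.
  rewrite (mdb_unsupported M HM _ i h u Hu); [lra|].
  intros Hs. apply Hi, supported_iff; auto.
Qed.

Lemma basis_indep_on_cell (M : mdspace) (HM : valid_mdspace M) (c c' : nat -> R)
  (h : nat) : (h <= nbk M)%nat ->
  (forall u, in_cell M h u ->
     rsum (fun i => c i * mdb_basis M i u) 1 (dimS M) =
     rsum (fun i => c' i * mdb_basis M i u) 1 (dimS M)) ->
  forall i, (Tcount M h < i <= Lcount M h)%nat -> c i = c' i.
Proof.
  intros Hh Heq i Hi. destruct (all_levels M HM (max_deg M) (le_n _)) as [_ Hind].
  enough (c i - c' i = 0) by lra.
  apply (Hind h (fun i => c i - c' i) Hh).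
  - unfold active. lia.
  - intros u Hu. assert (Hc : in_cell M h u) by (split; [assumption|lra]).
    rewrite <- (basis_sum_on_cell M HM _ h u Hc).
    rewrite (rsum_ext _ (fun i => c i * mdb_basis M i u - c' i * mdb_basis M i u))
      by (intros; ring).
    rewrite rsum_minus, (Heq u Hc). lra.
  - unfold supported. lia.
Qed.

Lemma greville_on_cell (M : mdspace) (xi : nat -> R) (h : nat) (u : R) :
  is_greville M xi -> (1 <= deg M h)%nat -> in_cell M h u ->
  rsum (fun i => xi i * mdb_basis M i u) 1 (dimS M) = u.
Proof.
  intros Hxi Hd [Hh Hu]. rewrite <- rsum_sum_n_m by lia.
  replace (1 + dimS M - 1)%nat with (dimS M) by lia. apply (Hxi h); auto; lra.
Qed.

(** Differentiating [sum xi_i N_{i,m} = x] on a cell gives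
    [sum (xi_i - xi_{i-1}) delta_{i,m-1} N_{i,m-1} = 1], while the
    [N_{i,m-1}] also sum to 1 there. *)
Lemma greville_increment (M : mdspace) (HM : valid_mdspace M) (xi : nat -> R)
  (h i : nat) :
  is_greville M xi -> (h <= nbk M)%nat -> (1 <= deg M h)%nat ->
  (Tcount M h + 1 < i <= Lcount M h)%nat ->
  xi i - xi (i - 1)%nat = mdb_integral M (max_deg M - 1) i.
Proof.
  intros Hxi Hh Hd Hi. pose proof (deg_le_max M h Hh) as Hmax.
  remember (max_deg M - 1)%nat as n eqn:En.
  assert (Hm : max_deg M = S n) by lia.
  destruct (all_levels M HM n ltac:(lia)) as [Hn Hind].
  destruct (all_levels M HM (S n) ltac:(lia)) as [HSn _].
  (* [deg M h >= 1] is what makes the cell active one level below the top. *)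
  assert (Ha : active M n h) by (unfold active; lia).
  assert (Hs : supported M n i h) by (unfold supported; lia).
  assert (Hne : mdb_integral M n i <> 0).
  { apply mdb_integral_nonzero; auto. now apply (supported_defined M HM n i h). }
  enough ((xi i - xi (i - 1)%nat) / mdb_integral M n i - 1 = 0) as Hq.
  { apply (Rmult_eq_reg_r (/ mdb_integral M n i)); [|now apply Rinv_neq_0_compat].
    rewrite Rinv_r by assumption. unfold Rdiv in Hq. lra. }
  apply (Hind h (fun i => (xi i - xi (i - 1)%nat) / mdb_integral M n i - 1) Hh Ha);
    [|assumption].
  intros u Hu. assert (Hc : in_cell M h u) by (split; [assumption|lra]).
  pose proof (supp_sum_derive M HM n Hn ltac:(lia)
    (fun i => xi i - xi (i - 1)%nat) h u Hh Hu) as HD.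
  apply is_derive_unique in HD.
  assert (H1 : supp_sum M n h
    (fun i => (xi i - xi (i - 1)%nat) / mdb_integral M n i * mdb M n i u) = 1).
  { rewrite <- HD. apply is_derive_unique.
    (* By summation by parts the sum of the [(xi_i - xi_{i-1}) C_{i,n}] is [x] minus the first
       coefficient in the window. *)
    apply (is_derive_ext_loc (fun x => x + - xi (Tcount M h + max_deg M - n)%nat)).
    - apply (locally_open_interval (bkpt M h) (bkpt M (h + 1))); [assumption|].
      intros v Hv. assert (Hcv : in_cell M h v) by (split; [assumption|lra]).
      pose proof (greville_on_cell M xi h v Hxi Hd Hcv) as Hg.
      rewrite (basis_sum_on_cell M HM xi h v Hcv), Hm in Hg.
      rewrite (supp_sum_abel M HM n HSn ltac:(lia) xi h v Hcv Ha) in Hg. lra.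
    - rewrite <- (Rplus_0_r 1).
      apply (is_derive_plus (fun x : R => x)).
      + apply (is_derive_id (K := R_AbsRing)).
      + apply (is_derive_const (- xi (Tcount M h + max_deg M - n)%nat)). }
  pose proof (mdb_partition_of_unity M HM n Hn ltac:(lia) h u Hc Ha) as H2.
  unfold supp_sum in *.
  rewrite (rsum_ext _ (fun i => (xi i - xi (i - 1)%nat) / mdb_integral M n i
    * mdb M n i u - mdb M n i u)) by (intros; ring).
  rewrite rsum_minus. lra.
Qed.

(** * Lowering the smoothness at a breakpoint *)

Lemma lower_smoothness_valid (M : mdspace) (j : nat) :
  valid_mdspace M -> valid_mdspace (lower_smoothness M j).
Proof.
  intros [Hx Hk]. split; [exact Hx|].
  intros i Hi. specialize (Hk i Hi). simpl. destruct Nat.eqb; lia.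
Qed.

(** One more copy of [x_j] enters the left partition, since [d_j - (k_j - 1)] exceeds [d_j - k_j] by
    one when [1 <= k_j <= d_j]; it is counted from cell [j] on. *)
Lemma Lcount_lower (M : mdspace) (HM : valid_mdspace M) (j h : nat) :
  (1 <= j <= nbk M)%nat -> (1 <= smooth M j)%nat -> (h <= nbk M)%nat ->
  Lcount (lower_smoothness M j) h =
  (Lcount M h + if Nat.leb j h then 1 else 0)%nat.
Proof.
  intros Hj Hk. induction h as [|h IH]; intros Hh.
  - replace (Nat.leb j 0) with false by (symmetry; apply Nat.leb_gt; lia).
    now rewrite Nat.add_0_r.
  - rewrite !Lcount_S, IH by lia. cbn [lower_smoothness deg smooth].
    destruct HM as [_ Hs]. specialize (Hs (S h) ltac:(lia)).
    destruct (Nat.eqb_spec (S h) j) as [<-|Hne].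
    + rewrite Nat.leb_refl. replace (Nat.leb (S h) h) with false
        by (symmetry; apply Nat.leb_gt; lia). lia.
    + destruct (Nat.leb_spec j h), (Nat.leb_spec j (S h)); lia.
Qed.

Theorem proposition3
  (S : mdspace) (HS : valid_mdspace S)
  (j : nat) (Hj : (1 <= j <= nbk S)%nat) (Hkj : (1 <= smooth S j)%nat)
  (l : nat) (Hl : (1 <= l <= dimS S)%nat)
  (Hsl : sknot S l <= bkpt S j < Rmin (sknot S (l + 1)) (right_end S))
  (alpha : nat -> R)
  (Halpha1 : forall i, (1 <= i <= l - deg S j)%nat -> alpha i = 1)
  (Halpha01 : forall i,
     (l - deg S j + 1 <= i <= l - deg S j + smooth S j)%nat -> 0 < alpha i < 1)
  (Halpha0 : forall i,
     (l - deg S j + smooth S j + 1 <= i <= dimS S + 1)%nat -> alpha i = 0)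
  (Hins : forall i, (1 <= i <= dimS S)%nat ->
     forall u, left_end S <= u <= right_end S ->
       mdb_basis S i u =
         alpha i * mdb_basis (lower_smoothness S j) i u
         + (1 - alpha (i + 1)%nat) * mdb_basis (lower_smoothness S j) (i + 1) u)
  (xi xi_hat : nat -> R)
  (Hxi : is_greville S xi)
  (Hxi_hat : is_greville (lower_smoothness S j) xi_hat) :
  forall i, (l - deg S j + 1 <= i <= l - deg S j + smooth S j)%nat ->
    alpha i = (xi_hat i - xi (i - 1)%nat) / (xi i - xi (i - 1)%nat).
Proof.
  intros i Hi. set (S' := lower_smoothness S j) in *.
  pose proof (lower_smoothness_valid S j HS) as HS'. fold S' in HS'.
  assert (Hcell : in_cell S j (bkpt S j)).
  { split; [lia|]. pose proof (bkpt_lt_succ S HS j ltac:(lia)). lra. }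
  (* The hypothesis on [l] says that exactly [l] left knots are at most [x_j], so
     [l - d_j = Tcount S j + 1]. *)
  assert (HlL : l = Lcount S j).
  { pose proof (proj1 (sknot_le_iff S HS j l _ Hcell) (proj1 Hsl)).
    pose proof (proj2 (sknot_le_iff S HS j (l + 1) _ Hcell)) as Hlt.
    pose proof (Rmin_l (sknot S (l + 1)) (right_end S)).
    destruct (Nat.le_gt_cases (l + 1) (Lcount S j)) as [Hc|]; [|lia].
    specialize (Hlt Hc). lra. }
  pose proof (Lcount_Tcount S HS j ltac:(lia)) as HLT.
  pose proof (Lcount_Tcount S' HS' j (proj2 Hj)) as HLT'. simpl deg in HLT'.
  pose proof (Lcount_lower S HS j j Hj Hkj ltac:(lia)) as HL'.
  rewrite Nat.leb_refl in HL'. fold S' in HL'.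
  assert (HK : dimS S' = (dimS S + 1)%nat).
  { rewrite !dimS_Lcount. simpl nbk. unfold S'.
    rewrite (Lcount_lower S HS j (nbk S)) by lia.
    now rewrite (proj2 (Nat.leb_le j (nbk S))) by lia. }
  assert (Hk : (smooth S j <= deg S j)%nat).
  { destruct HS as [_ Hs]. specialize (Hs j Hj). lia. }
  assert (Hd : (1 <= deg S j)%nat) by lia.
  (* Coefficients of [sum xi_r N_r] in the finer basis, after collecting the terms in [N^_r]; the
     conditionals discard the nonexistent [xi_{K+1}] and [xi_0]. *)
  pose (c := fun r => (if Nat.eqb r (dimS S + 1) then 0 else xi r * alpha r)
    + (if Nat.eqb r 1 then 0 else xi (r - 1)%nat * (1 - alpha r))).
  assert (Hhat : xi_hat i = c i).
  { apply (basis_indep_on_cell S' HS' xi_hat c j (proj2 Hj)); [|lia].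
    intros u Hu. rewrite (greville_on_cell S' xi_hat j u Hxi_hat Hd Hu).
    transitivity (rsum (fun r => xi r * mdb_basis S r u) 1 (dimS S)).
    { symmetry. now apply (greville_on_cell S xi j u). }
    pose proof (in_cell_bounds S HS j u Hu) as Hab.
    rewrite (rsum_ext (fun r => xi r * mdb_basis S r u) (fun r => xi r * alpha r * mdb_basis S' r u
      + xi (r + 1 - 1)%nat * (1 - alpha (r + 1)%nat) * mdb_basis S' (r + 1) u)).
    2: { intros r Hr. rewrite Hins by (lia || lra). rewrite Nat.add_sub. ring. }
    rewrite rsum_plus.
    rewrite (rsum_shift
      (fun r => xi (r - 1)%nat * (1 - alpha r) * mdb_basis S' r u)).
    rewrite (rsum_ext (fun r => c r * mdb_basis S' r u) (fun r =>
      (if Nat.eqb r (dimS S + 1) then 0 else xi r * alpha r) * mdb_basis S' r u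
      + (if Nat.eqb r 1 then 0 else xi (r - 1)%nat * (1 - alpha r))
        * mdb_basis S' r u) 1 (dimS S')) by (intros; unfold c; ring).
    rewrite rsum_plus, HK. f_equal.
    - rewrite Nat.add_1_r. cbn [rsum].
      change (1 + dimS S)%nat with (Datatypes.S (dimS S)).
      rewrite Nat.eqb_refl, Rmult_0_l, Rplus_0_r.
      apply rsum_ext. intros r Hr.
      destruct (Nat.eqb_spec r (Datatypes.S (dimS S))); [lia|reflexivity].
    - rewrite Nat.add_1_r, rsum_first, Rmult_0_l, Rplus_0_l.
      apply rsum_ext. intros r Hr.
      destruct (Nat.eqb_spec r 1); [lia|reflexivity]. }
  unfold c in Hhat.
  pose proof (Lcount_le S j (nbk S) ltac:(lia)) as HLK. rewrite <- dimS_Lcount in HLK.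
  (* Here [2 <= i <= K], so neither exceptional case occurs. *)
  rewrite (proj2 (Nat.eqb_neq i (dimS S + 1))) in Hhat by lia.
  rewrite (proj2 (Nat.eqb_neq i 1)) in Hhat by lia.
  (* This difference is the integral of [N_{i,m-1}], which is supported on cell [j] because
     [Tcount S j + 2 <= i <= Lcount S j]. *)
  assert (Hne : xi i - xi (i - 1)%nat <> 0).
  { rewrite (greville_increment S HS xi j i Hxi ltac:(lia) Hd ltac:(lia)).
    destruct (all_levels S HS (max_deg S - 1) ltac:(lia)) as [Hn Hind].
    apply mdb_integral_nonzero; try assumption.
    apply (supported_defined S HS _ i j); [lia|].
    pose proof (deg_le_max S j ltac:(lia)). unfold supported. lia. }
  rewrite Hhat. field. exact Hne.
Qed.
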